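(* Let $P$ be the transition kernel on $\mathbb{R}^d$ of the nonlinear autoregressive process $\Phi_{n+1}=g(\Phi_n)+\varepsilon_{n+1}$, i.e. $P(x,A)=\mathbb{P}(g(x)+\varepsilon_0\in A)$, where the noise and the function $g$ satisfy the assumptions given in the context, with constants $z_0>0$, $\gamma_0\in(0,1]$, $\rho\in[0,2)$. Assume in addition that $|g(x)|\le|x|$ for all $x\in\mathbb{R}^d$. Then the chain is $\psi$-irreducible and aperiodic, and compact sets belonging to $\mathcal{B}^+(\mathbb{R}^d)$ are petite. If $\rho>\gamma_0$, then there exist $z_*\in(0,z_0)$, $c>0$ and $z\in(0,z_0)$ such that, with $V(x):=e^{z_*|x|^{\gamma_0\wedge(2-\rho)}}$, any probability measure $\lambda$ on $\mathbb{R}^d$ satisfying $\lambda(V)<\infty$ is $(f,r)$-regular with $$r(n)=e^{c\,n^{\{\gamma_0\wedge(2-\rho)\}/\rho}}\qquad\text{and}\qquad f(x)=e^{z|x|^{\gamma_0\wedge(2-\rho)}}.$$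
   Context: $|\cdot|$ is the Euclidean norm and $a\wedge b=\min(a,b)$. Noise assumption: $(\varepsilon_n)_{n\ge0}$ is a sequence of i.i.d. zero mean $d$-dimensional random vectors, independent of $\Phi_0$, with $\mathbb{E}\bigl[e^{z_0|\varepsilon_0|^{\gamma_0}}\bigr]<\infty$ for some $z_0>0$ and $\gamma_0\in(0,1]$, and the distribution of $\varepsilon_0$ has a nontrivial absolutely continuous component which is bounded away from zero in a neighborhood of the origin. Assumption on $g$: $g:\mathbb{R}^d\to\mathbb{R}^d$ is continuous and there exist $r_0,R_0>0$ and $\rho\in[0,2)$ such that $|g(x)|\le|x|\,(1-r_0|x|^{-\rho})$ whenever $|x|\ge R_0$. $\psi$ is a maximal irreducibility measure; $\mathcal{B}^+(\mathbb{R}^d)$ is the class of Borel sets $B$ with $\psi(B)>0$; $\tau_B=\inf\{n\ge1:\Phi_n\in B\}$. A measurable set $C$ is petite if there are a probability distribution $(a(n))_{n\ge0}$ on $\mathbb{N}$ and a nontrivial measure $\psi_a$ with $\sum_{n\ge0}a(n)P^n(x,B)\ge\psi_a(B)$ for all $x\in C$ and Borel $B$. A probability measure $\lambda$ is $(f,r)$-regular if $\mathbb{E}_\lambda\bigl[\sum_{k=0}^{\tau_B-1}r(k)f(\Phi_k)\bigr]<\infty$ for all $B\in\mathcal{B}^+(\mathbb{R}^d)$, where $\mathbb{E}_\lambda$ is expectation for $\Phi_0\sim\lambda$. *)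

(* Defs.v *)
From HB Require Import structures.
From mathcomp Require Import all_boot all_order all_algebra finmap.
From mathcomp Require Import all_classical all_reals all_analysis.
From mathcomp Require Import measurable_realfun.

Set Implicit Arguments.
Unset Strict Implicit.
Unset Printing Implicit Defensive.

Import Order.TTheory GRing.Theory Num.Theory.
Import numFieldNormedType.Exports.

Local Open Scope classical_set_scope.
Local Open Scope ring_scope.

(* R^d is ['rV[R]_d]. Its library norm [`|x|] is the sup norm, which induces
   the usual topology; the Euclidean norm is [enorm]. *)

Section euclidean_space.
Context {R : realType}.

HB.instance Definition _ d :=
  @isMeasurable.Build (sigma_display (@open 'rV[R]_d)) 'rV[R]_d
    <<s @open 'rV[R]_d >> (@sigma_algebra0 _ setT _) (@sigma_algebraC _ _)
    (@sigma_algebra_bigcup _ setT _).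

Definition enorm d (x : 'rV[R]_d) : R := Num.sqrt (\sum_i x ord0 i ^+ 2).

Lemma open_measurable_rV d (U : set 'rV[R]_d) : open U -> measurable U.
Proof. by move=> oU; exact: sub_sigma_algebra. Qed.

Lemma measurable_coord_rV d (i : 'I_d) :
  measurable_fun [set: 'rV[R]_d] (fun x => x ord0 i : R).
Proof.
apply: (measurability _ (RGenOInfty.measurableE R)) => _ [_ [a ->] <-].
rewrite setTI; apply: open_measurable_rV.
apply: open_comp; last exact: interval_open.
by move=> x _; exact: coord_continuous.
Qed.

Lemma open_bigcup_rat_ball d (U : set 'rV[R]_d) : open U ->
  U = \bigcup_(qk : 'rV[rat]_d * nat)
        [set x | ball (map_mx ratr qk.1 : 'rV[R]_d) qk.2.+1%:R^-1 x /\
           ball (map_mx ratr qk.1 : 'rV[R]_d) qk.2.+1%:R^-1 `<=` U].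
Proof.
move=> oU; apply/seteqP; split=> [x Ux|x [[q k] _ [qx]]]; last exact.
have /nbhs_ballP[e /= e0 eU] : nbhs x U by exact: open_nbhs_nbhs.
have [k ke] : exists k, k.+1%:R^-1 < e / 2 :> R.
  have e20 : 0 < e / 2 by rewrite divr_gt0.
  have [k _ hk] := near_infty_natSinv_lt (PosNum e20).
  by exists k; exact: (hk k (leqnn k)).
have k0 : 0 < k.+1%:R^-1 :> R by rewrite invr_gt0.
have qP (i : 'I_d) : exists q : rat, ball (x ord0 i) k.+1%:R^-1 (ratr q : R).
  have [] := @dense_rat R (ball (x ord0 i) k.+1%:R^-1).
  - by exists (x ord0 i); exact: ballxx.
  - exact: ball_open.
  - by move=> y [+ [q _ qy]]; rewrite -qy; exists q.
pose q : 'rV[rat]_d := \row_i sval (cid (qP i)).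
have xq : ball x k.+1%:R^-1 (map_mx ratr q : 'rV[R]_d).
  by split => // a i; rewrite !mxE (ord1 a); case: cid.
exists (q, k) => //=; split; first exact: ball_sym.
move=> y qy; apply: eU; apply: le_ball (ball_triangle xq qy).
by rewrite [leRHS]splitr lerD// ltW.
Qed.

Lemma measurable_fun_rV dS (S : measurableType dS) d (f : S -> 'rV[R]_d) :
  (forall i, measurable_fun [set: S] (fun s => f s ord0 i : R)) ->
  measurable_fun [set: S] f.
Proof.
move=> mf; apply: (@measurability _ _ _ _ _ _ (@open 'rV[R]_d)) => // _ [U oU <-].
rewrite setTI (open_bigcup_rat_ball oU) preimage_bigcup.
apply: countable_bigcupT_measurable => // -[q k] /=.
set B := ball _ _.
have [BU|BU] := pselect (B `<=` U); last first.
  rewrite [X in measurable X](_ : _ = set0)//.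
  by apply/seteqP; split => // s [].
rewrite [X in measurable X](_ : _ = \bigcap_(i in [set: 'I_d])
    ((fun s => f s ord0 i : R) @^-1` ball (ratr (q ord0 i) : R) k.+1%:R^-1)).
  apply: fin_bigcap_measurable => // i _; rewrite -[X in measurable X]setTI.
  by apply: mf => //; exact: measurable_ball.
apply/seteqP; split => [s [[_ sB] _] i _|s sB].
  by have := sB ord0 i; rewrite !mxE.
split => //; split; first by rewrite invr_gt0.
by move=> a i; rewrite (ord1 a) mxE; exact: sB.
Qed.

Definition consrV d (p : 'rV[R]_d * measurableTypeR R) : 'rV[R]_d.+1 :=
  row_mx (p.2 : R)%:M p.1.

Lemma measurable_consrV d : measurable_fun setT (@consrV d).
Proof.
apply: measurable_fun_rV => i; rewrite /consrV.
case: (split_ordP (i : 'I_(1 + d))) => j ->.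
  rewrite (_ : (fun _ => _) = snd); first exact: measurable_snd.
  by apply/funext => p; rewrite [LHS]row_mxEl mxE !ord1 eqxx mulr1n.
rewrite (_ : (fun _ => _) = (fun x : 'rV[R]_d => x ord0 j : R) \o fst).
  by apply: measurableT_comp; [exact: measurable_coord_rV|exact: measurable_fst].
by apply/funext => p; rewrite [LHS]row_mxEr.
Qed.

Section lebesgue_cons.
Context d (mu : {measure set 'rV[R]_d -> \bar R}).

Definition lebesgue_cons : set 'rV[R]_d.+1 -> \bar R :=
  pushforward (mu \x lebesgue_measure)%E (@consrV d).

Let lebesgue_cons0 : lebesgue_cons set0 = 0%E.
Proof. by rewrite /lebesgue_cons /pushforward preimage_set0 measure0. Qed.

Let lebesgue_cons_ge0 A : (0 <= lebesgue_cons A)%E.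
Proof. by apply: integral_ge0 => x _; exact: measure_ge0. Qed.

Let lebesgue_cons_sigma_additive : semi_sigma_additive lebesgue_cons.
Proof.
exact: (@measure_semi_sigma_additive _ _ _
  (measure_function_pushforward__canonical__measure_function_Measure
    (mu \x lebesgue_measure)%E (@measurable_consrV d))).
Qed.

HB.instance Definition _ := isMeasure.Build _ _ _ lebesgue_cons
  lebesgue_cons0 lebesgue_cons_ge0 lebesgue_cons_sigma_additive.

End lebesgue_cons.

(* Iterated product of the one-dimensional Lebesgue measure, transported along
   R^d * R -> R^(d+1); see [lebesgue_rV_box]. *)
Fixpoint lebesgue_rV d : {measure set 'rV[R]_d -> \bar R} :=
  match d return {measure set 'rV[R]_d -> \bar R} with
  | 0%N => \d_(0 : 'rV[R]_0)
  | d'.+1 => lebesgue_cons (lebesgue_rV d')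
  end.

Lemma lebesgue_rV_box d (A : 'I_d -> set (measurableTypeR R)) :
  (forall i, measurable (A i)) ->
  lebesgue_rV d [set x | forall i, A i (x ord0 i)] =
  (\prod_(i < d) lebesgue_measure (A i))%E.
Proof.
elim: d A => [A _|d IH A mA].
  rewrite big_ord0 /= diracE mem_set//= => -[]//.
rewrite big_ord_recl /= /lebesgue_cons /pushforward.
rewrite (_ : _ @^-1` _ =
    [set x : 'rV[R]_d | forall i, A (lift ord0 i) (x ord0 i)] `*` A ord0).
  rewrite product_measure1E//.
    by rewrite muleC; congr (_ * _)%E; exact: (IH (fun i => A (lift ord0 i))).
  rewrite (_ : mkset _ = \bigcap_(i in [set: 'I_d])
      ((fun x : 'rV[R]_d => x ord0 i : R) @^-1` A (lift ord0 i))).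
    apply: fin_bigcap_measurable => // i _; rewrite -[X in measurable X]setTI.
    by apply: measurable_coord_rV => //; exact: mA.
  by apply/seteqP; split=> [x Ax i _|x Ax i]; [exact: Ax|exact: (Ax i Logic.I)].
have cons0 (p : 'rV[R]_d * measurableTypeR R) : consrV p ord0 ord0 = p.2.
  rewrite /consrV (_ : ord0 = lshift d (ord0 : 'I_1)); last exact: val_inj.
  by rewrite [LHS]row_mxEl mxE eqxx mulr1n.
have consS (p : 'rV[R]_d * measurableTypeR R) i :
    consrV p ord0 (lift ord0 i) = p.1 ord0 i.
  rewrite /consrV (_ : lift _ _ = rshift 1 i); last exact: val_inj.
  by rewrite [LHS]row_mxEr.
apply/seteqP; split=> [p /= Ap|p [/= Ap1 Ap2] i].
  split=> [i|]; first by rewrite -consS; exact: Ap.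
  by rewrite /= -cons0; exact: Ap.
case: (unliftP ord0 i) => [j ->|->]; first by rewrite consS; exact: Ap1.
by rewrite cons0.
Qed.

End euclidean_space.

Section noise.
Context {R : realType} {d : nat} {dO : measure_display} {Omega : measurableType dO}.
Variable Pr : probability Omega R.
Implicit Types (X : {RV Pr >-> 'rV[R]_d}) (eps : nat -> {RV Pr >-> 'rV[R]_d}).

Definition mutually_independent eps :=
  forall (J : {fset nat}) (A : nat -> set 'rV[R]_d),
    (forall j, measurable (A j)) ->
    Pr (\bigcap_(j in [set` J]) (eps j @^-1` A j)) =
    (\prod_(j <- J) Pr (eps j @^-1` A j))%E.

Definition identically_distributed eps :=
  forall n A, measurable A ->
    distribution Pr (eps n) A = distribution Pr (eps 0%N) A.

(* Cylinder events generate the sigma-algebra of the whole sequence [eps]. *)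
Definition independent_of_sequence X eps :=
  forall (B : set 'rV[R]_d) (J : {fset nat}) (A : nat -> set 'rV[R]_d),
    measurable B -> (forall j, measurable (A j)) ->
    Pr (X @^-1` B `&` \bigcap_(j in [set` J]) (eps j @^-1` A j)) =
    (Pr (X @^-1` B) * Pr (\bigcap_(j in [set` J]) (eps j @^-1` A j)))%E.

Definition zero_mean X := forall i : 'I_d,
  Pr.-integrable [set: Omega] (fun w => (X w ord0 i)%:E) /\
  ('E_Pr[(fun w => X w ord0 i : R)] = 0)%E.

Definition subexponential_moment (z0 gamma0 : R) X :=
  (\int[Pr]_w (expR (z0 * enorm (X w) `^ gamma0))%:E < +oo)%E.

End noise.

(* The Lebesgue decomposition of [mu] has a nontrivial absolutely continuous
   part, with a density [p] bounded away from zero near the origin. *)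
Definition ac_component_positive_near0 (R : realType) d
    (mu : {measure set 'rV[R]_d -> \bar R}) :=
  exists (mu_ac mu_s : {measure set 'rV[R]_d -> \bar R}) (p : 'rV[R]_d -> R),
  [/\ forall A, measurable A -> mu A = (mu_ac A + mu_s A)%E,
      exists N, [/\ measurable N, lebesgue_rV d N = 0%E & mu_s (~` N) = 0%E],
      [/\ measurable_fun [set: 'rV[R]_d] p, (forall x, 0 <= p x) &
        forall A, measurable A ->
          mu_ac A = (\int[lebesgue_rV d]_(x in A) (p x)%:E)%E],
      (0 < mu_ac [set: 'rV[R]_d])%E &
      exists2 c : R, 0 < c & \forall x \near (0 : 'rV[R]_d), c <= p x].

Definition noise_assumption (R : realType) d (dO : measure_display)
    (Omega : measurableType dO) (Pr : probability Omega R)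
    (Phi0 : {RV Pr >-> 'rV[R]_d}) (eps : nat -> {RV Pr >-> 'rV[R]_d})
    (z0 gamma0 : R) :=
  [/\ mutually_independent eps /\ identically_distributed eps,
      independent_of_sequence Phi0 eps,
      forall n, zero_mean (eps n),
      subexponential_moment z0 gamma0 (eps 0%N) &
      ac_component_positive_near0 (distribution Pr (eps 0%N))].

Definition drift_assumption (R : realType) d (g : 'rV[R]_d -> 'rV[R]_d)
    (rho : R) :=
  continuous g /\
  exists r0 R0 : R, [/\ 0 < r0, 0 < R0 & forall x, R0 <= enorm x ->
    enorm (g x) <= enorm x * (1 - r0 * enorm x `^ (- rho))].

Section markov.
Context {R : realType} {dT : measure_display} {T : measurableType dT}.
Variable P : R.-pker T ~> T.
Local Open Scope ereal_scope.

Fixpoint kiter (n : nat) : R.-spker T ~> T :=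
  match n with
  | 0%N => kdirac (@measurable_id _ T setT)
  | m.+1 => mkcomp_noparam P (kiter m)
  end.

Definition irreducibility_measure (phi : {sigma_finite_measure set T -> \bar R}) :=
  0 < phi setT /\
  forall A, measurable A -> 0 < phi A ->
    forall x, exists2 n, (0 < n)%N & 0 < kiter n x A.

Definition maximal_irreducibility_measure
    (psi : {sigma_finite_measure set T -> \bar R}) :=
  irreducibility_measure psi /\
  forall phi : {sigma_finite_measure set T -> \bar R},
    irreducibility_measure phi -> phi `<< psi.

Definition psi_irreducible :=
  exists psi : {sigma_finite_measure set T -> \bar R},
    maximal_irreducibility_measure psi.

Definition Bplus (psi : {measure set T -> \bar R}) : set (set T) :=
  [set B | measurable B /\ 0 < psi B].

Definition is_cycle (psi : {measure set T -> \bar R}) n (D : 'I_n -> set T) :=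
  [/\ forall i, measurable (D i),
      trivIset setT D,
      forall i x, D i x -> P x (D (ordS i)) = 1 &
      psi (~` \bigcup_i D i) = 0].

(* The period is the largest length of a cycle (the whole space is always a
   cycle of length 1); the chain is aperiodic when it equals 1. *)
Definition aperiodic (psi : {measure set T -> \bar R}) :=
  forall n (D : 'I_n -> set T), (0 < n)%N -> is_cycle psi D -> n = 1%N.

Definition petite (C : set T) :=
  measurable C /\
  exists (a : nat -> R) (psi_a : {measure set T -> \bar R}),
  [/\ forall n, (0 <= a n)%R,
      \sum_(n <oo) (a n)%:E = 1,
      0 < psi_a setT &
      forall x B, C x -> measurable B ->
        psi_a B <= \sum_(n <oo) (a n)%:E * kiter n x B].

Section chain.
Context {dO : measure_display} {Omega : measurableType dO}.
Variable Q : probability Omega R.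
Implicit Type Phi : nat -> {RV Q >-> T}.

(* The Markov property Q(Phi_{n+1} \in B | Phi_0, ..., Phi_n) = P(Phi_n, B),
   tested on the events {Phi_0 \in A_0, ..., Phi_n \in A_n}, which form a
   pi-system generating the past. *)
Definition markov_chain (lam : probability T R) Phi :=
  (forall A, measurable A -> distribution Q (Phi 0%N) A = lam A) /\
  forall n (A : nat -> set T) B, (forall k, measurable (A k)) -> measurable B ->
    let past := \bigcap_(k in `I_n.+1) (Phi k @^-1` A k) in
    Q (past `&` Phi n.+1 @^-1` B) = \int[Q]_(w in past) P (Phi n w) B.

Definition hitting_time Phi (B : set T) (w : Omega) : \bar R :=
  ereal_inf [set n%:R%:E | n in [set n | (0 < n)%N /\ B (Phi n w)]].

End chain.

(* The expectation only depends on the law of the chain, which is determined by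
   [lam] and [P]; it is therefore taken over any realization of the chain. *)
Definition regular (psi : {measure set T -> \bar R}) (f : T -> R) (r : nat -> R)
    (lam : probability T R) :=
  forall B, Bplus psi B ->
  forall (dO : measure_display) (Omega : measurableType dO)
    (Q : probability Omega R) (Phi : nat -> {RV Q >-> T}),
  markov_chain lam Phi ->
  \int[Q]_w (\sum_(k <oo | k%:R%:E < hitting_time Phi B w)
               (r k * f (Phi k w))%:E) < +oo.

End markov.

(* Main.v *)
Require Import Defs.
From HB Require Import structures.
From mathcomp Require Import all_boot all_order all_algebra finmap.
From mathcomp Require Import all_classical all_reals all_analysis.
From mathcomp Require Import measurable_realfun.
From mathcomp Require Import ring lra.

Set Implicit Arguments.
Unset Strict Implicit.
Unset Printing Implicit Defensive.

Import Order.TTheory GRing.Theory Num.Theory.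
Import numFieldNormedType.Exports.

Local Open Scope classical_set_scope.
Local Open Scope ring_scope.

(** Two mechanisms carry the proof.

    Near the origin.  The noise has a density at least [c] on the ball of radius
    [delta], so a step from [x] charges every set close to [g x] at least as much
    as [c] times Lebesgue measure does.  Because [|g x| <= |x|], points of norm at
    most [delta / 3] all dominate one and the same measure, [c] times Lebesgue
    measure on that ball ([kernel_minorization]), while from an arbitrary [x] one
    step lowers the norm by [delta / 6], or brings it below [delta / 3], with a
    probability bounded below uniformly in [x] ([kernel_contraction]).  Iterating,
    all points of a bounded set dominate a common multiple of a fixed measure [nu]
    after a common number of steps ([uniform_minorization]).  Irreducibility,
    aperiodicity and petiteness of bounded sets follow, and so does a uniform lower
    bound [p] on the probability of being, [N] steps after a visit to a bounded
    set, in a given set [B] of positive measure ([minorized_reaches]).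

    At infinity.  With [theta = min(gamma0, 2 - rho)], the function
    [V x = exp (z |x|^theta)] satisfies
    [P V <= (1 - kappa |x|^(theta - rho)) V] outside a ball [C]
    ([autoregressive_drift]): the contraction of [g] gains a factor of order
    [z |x|^(theta - rho)] in the exponent, the first-order effect of the noise
    vanishes because it is centred, and its second-order effect is of order
    [z |x|^(theta - 2) + z^2 |x|^(2 theta - 2)], where the first term is of smaller
    order since [rho < 2] and the second is small for small [z] since
    [theta <= 2 - rho].

    From drift to rates.  Let [alpha = theta / rho < 1].  To bound the probability
    of staying outside [C] during [n] steps, cut space at level
    [M = n^(1/rho)]: below [M] the drift contracts by at least
    [1 - kappa M^(theta - rho)] per step, above [M] the function [V] exceeds
    [exp (z M^theta)], and for this [M] both effects give [exp (- s n^alpha)]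
    with [s = min(kappa, z)] ([taboo_le_stretched]).  Let [a_k] be the probability
    that [B] is not hit up to time [k], and [c_k] that of being moreover in [C] at
    time [k].  Decomposing at the last visit to [C] bounds [a_k] by the convolution
    of [exp (- s n^alpha)] with [c], and the reachability of [B] from [C] gives
    [p c_k <= a_k - a_(k + N)].  A weight [r k = exp (b k^alpha)] with [b < s]
    satisfies [r (k + N) - r k = o(r (k + N))], so summation by parts makes
    [sum r_k c_k] at most a constant plus an arbitrarily small multiple of
    [sum r_k a_k]; the convolution bound then absorbs it and the latter sum is
    finite ([renewal_bounded]).  Only the multiple depends on [B], not [r], which is
    why one pair [(f, r)] serves all sets [B].  Finally [r f <= r^2 + f^2] reduces
    the joint statement to this sum and to the sum of the expectations of [f^2],
    which the drift inequality controls directly ([killed_law_drift]). *)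

(** * Elementary inequalities for real powers and the exponential *)

Section real_powers.
Context {R : realType}.
Implicit Types a b s t u p : R.

Lemma gt0_powRD a s t : 0 < a -> a `^ (s + t) = a `^ s * a `^ t.
Proof. by move=> a0; rewrite powRD//; apply/implyP => _; rewrite gt_eqF. Qed.

Lemma gt0_powRB1 a s : 0 < a -> a `^ (s - 1) = a `^ s / a.
Proof. by move=> a0; rewrite gt0_powRD// powRN powRr1// ltW. Qed.

Lemma powR_le1 t p : 0 <= t <= 1 -> 0 <= p -> t `^ p <= 1.
Proof.
move=> /andP[t0 t1] p0; have <- : 1 `^ p = 1 :> R by rewrite powR1.
by apply: ge0_ler_powR => //; rewrite nnegrE.
Qed.

(** The graph of a concave power lies below its tangents: weighted arithmetic and
    geometric means of [a / b] and [1]. *)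
Lemma powR_le_tangent a b s : 0 <= a -> 0 < b -> 0 <= s <= 1 ->
  a `^ s <= b `^ s + s * b `^ (s - 1) * (a - b).
Proof.
move=> a0 b0 /andP[s0 s1].
have b0' := ltW b0.
have -> : b `^ (s - 1) = b `^ s / b.
  exact: gt0_powRB1.
suff H : (a / b) `^ s <= 1 + s * (a / b - 1).
  have -> : a `^ s = b `^ s * (a / b) `^ s.
    by rewrite -powRM ?divr_ge0// mulrCA divff ?mulr1 ?gt_eqF.
  have -> : b `^ s + s * (b `^ s / b) * (a - b) = b `^ s * (1 + s * (a / b - 1)).
    by field; rewrite gt_eqF.
  by rewrite ler_wpM2l ?powR_ge0.
move: (a / b) (divr_ge0 a0 b0') => t t0.
move: s0; rewrite le_eqVlt => /predU1P[<-|s0].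
  by rewrite powRr0 mul0r addr0.
move: s1; rewrite le_eqVlt => /predU1P[->|s1].
  by rewrite powRr1// mul1r addrC subrK.
have := @conjugate_powR _ (t `^ s) 1 s^-1 (1 - s)^-1.
rewrite powR_ge0 ler01 !invr_gt0 s0 subr_gt0 s1 !invrK addrC subrK.
move=> /(_ isT isT isT isT erefl).
rewrite mulr1 -powRrM divff ?gt_eqF// powRr1// powR1 mul1r => h.
by apply: le_trans h _; rewrite le_eqVlt; apply/orP; left; apply/eqP; ring.
Qed.

(** The slope [b^(s-1)], rather than [s * b^(s-1)], is what also covers [a < b],
    where the chord from [0] to [b] lies below the graph. *)
Lemma powR_dist_le a b s : 0 <= a -> 0 < b -> 0 <= s <= 1 ->
  `|a `^ s - b `^ s| <= b `^ (s - 1) * `|a - b|.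
Proof.
move=> a0 b0 s01; have /andP[s0 s1] := s01.
have [ab|ab] := leP b a.
  rewrite !ger0_norm ?subr_ge0 ?ge0_ler_powR ?nnegrE ?(ltW b0)//.
  have := powR_le_tangent a0 b0 s01.
  rewrite -lerBlDl => /le_trans; apply.
  by rewrite ler_wpM2r ?subr_ge0// ler_piMl ?powR_ge0.
rewrite ler0_norm ?subr_le0 ?ge0_ler_powR ?nnegrE ?(ltW b0) ?(ltW ab)//.
rewrite ltr0_norm ?subr_lt0// !opprB.
have -> : b `^ (s - 1) = b `^ s / b.
  exact: gt0_powRB1.
have : a / b <= (a / b) `^ s.
  move: a0; rewrite le_eqVlt => /predU1P[<-|a0].
    by rewrite mul0r powR_ge0.
  by apply: ger1_powR => //; rewrite divr_gt0//= ler_pdivrMr// mul1r ltW.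
rewrite -(ler_pM2l (powR_gt0 s b0)) -powRM ?divr_ge0 ?(ltW b0)//.
rewrite [b * _]mulrCA divff ?gt_eqF// mulr1 => h.
rewrite mulrBr mulfVK ?gt_eqF// -mulrA [b^-1 * a]mulrC.
by rewrite lerD2l lerN2.
Qed.

Lemma powR_subadd a b s : 0 <= a -> 0 <= b -> 0 <= s <= 1 ->
  (a + b) `^ s <= a `^ s + b `^ s.
Proof.
move=> a0 b0 /andP[s0 s1].
have : 0 <= a + b by rewrite addr_ge0.
rewrite le_eqVlt => /predU1P[ab|ab].
  have a00 : a = 0 by lra.
  have b00 : b = 0 by lra.
  by rewrite a00 b00 addr0 lerDl powR_ge0.
have H x : 0 <= x -> x <= a + b -> (a + b) `^ s * (x / (a + b)) <= x `^ s.
  move=> x0 xab.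
  have -> : x `^ s = (a + b) `^ s * (x / (a + b)) `^ s.
    rewrite -powRM ?divr_ge0 ?(ltW ab)//.
    by rewrite mulrCA divff ?mulr1 ?gt_eqF.
  rewrite ler_wpM2l ?powR_ge0//.
  move: x0; rewrite le_eqVlt => /predU1P[<-|x0].
    by rewrite mul0r powR_ge0.
  by apply: ger1_powR => //; rewrite divr_gt0//= ler_pdivrMr// mul1r.
have := lerD (H a a0 _) (H b b0 _); rewrite lerDl lerDr => /(_ b0 a0).
by rewrite -mulrDr -mulrDl divff ?mulr1 ?gt_eqF.
Qed.

Lemma expR_le_quadratic u : expR u <= 1 + u + u ^+ 2 * expR `|u|.
Proof.
have e0 := expR_gt0 u.
have h1 : 1 + u <= expR u := expR_ge1Dx u.
have h2 : expR u <= 1 + u * expR u.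
  have := expR_ge1Dx (- u); rewrite expRN => h.
  have := ler_wpM2l (ltW e0) h; rewrite divff ?gt_eqF// mulrDr mulr1 mulrN.
  by rewrite [expR u * u]mulrC; lra.
have [u0|u0] := leP 0 u; first by rewrite ger0_norm//; nra.
have h3 : 1 <= expR `|u| by rewrite -expR0 ler_expR.
have h4 : u * expR u <= u + u ^+ 2 by nra.
have h5 : 0 <= u ^+ 2 by rewrite sqr_ge0.
nra.
Qed.

(** Exponentials of a power dominate powers: with [n >= p / q], compare
    [t^p <= (t^q)^n] with the [n]-th power of [1 + a t^q / n]. *)
Lemma powR_le_expR (q a p : R) : 0 < q -> 0 < a -> 0 <= p ->
  exists2 K : R, 0 < K & forall t, 0 <= t -> t `^ p <= K * expR (a * t `^ q).
Proof.
move=> q0 a0 p0.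
have [n pn] : exists n : nat, p / q < n%:R.
  by exists (Num.bound (p / q)); apply: archi_boundP; rewrite divr_ge0// ltW.
have n0 : 0 < n%:R :> R by apply: le_lt_trans pn; rewrite divr_ge0// ltW.
have K0 : 0 <= (n%:R / a) ^+ n by rewrite exprn_ge0// divr_ge0// ltW.
exists (1 + (n%:R / a) ^+ n); first by rewrite ltr_pwDl.
move=> t t0.
have tq0 := powR_ge0 t q.
have e1 : 1 <= expR (a * t `^ q) by rewrite -expR0 ler_expR mulr_ge0// ltW.
have [t1|t1] := leP t 1.
  apply: (@le_trans _ _ 1); first by rewrite powR_le1// t0.
  by rewrite mulr_ege1// lerDl.
apply: (@le_trans _ _ ((t `^ q) ^+ n)).
  rewrite -powR_mulrn// -powRrM; apply: ler_powR; first exact: ltW.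
  by rewrite mulrC -ler_pdivrMr// ltW.
apply: (@le_trans _ _ ((n%:R / a) ^+ n * expR (a * t `^ q))); last first.
  by rewrite ler_wpM2r ?expR_ge0// lerDr.
have -> : expR (a * t `^ q) = expR (a * t `^ q / n%:R) ^+ n.
  by rewrite -expRM_natl; congr expR; rewrite [RHS]mulrC divfK ?gt_eqF.
rewrite -exprMn; apply: lerXn2r; rewrite ?nnegrE//.
  by rewrite mulr_ge0 ?expR_ge0// divr_ge0// ltW.
rewrite -ler_pdivrMl ?divr_gt0// invf_div.
have := expR_ge1Dx (a * t `^ q / n%:R).
by apply: le_trans; rewrite mulrAC lerDr.
Qed.
End real_powers.

(** * Euclidean norm *)

Section euclidean_norm.
Context {R : realType} {d : nat}.
Implicit Types x y e : 'rV[R]_d.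

Definition dot x y : R := \sum_i x ord0 i * y ord0 i.

Lemma enorm_ge0 x : 0 <= enorm x.
Proof. exact: sqrtr_ge0. Qed.

Lemma sqr_enorm x : enorm x ^+ 2 = \sum_i x ord0 i ^+ 2.
Proof. by rewrite sqr_sqrtr// sumr_ge0// => i _; exact: sqr_ge0. Qed.

(** Expand the nonnegative sum of the [(|y|^2 x_i - <x,y> y_i)^2]. *)
Lemma cauchy_schwarz_dot x y : `|dot x y| <= enorm x * enorm y.
Proof.
suff H : dot x y ^+ 2 <= (enorm x * enorm y) ^+ 2.
  rewrite -(@ler_pXn2r _ 2) ?nnegrE//; last by rewrite mulr_ge0 ?enorm_ge0.
  by rewrite real_normK// num_real.
rewrite exprMn.
have [A AE] : {A | A = enorm x ^+ 2} by exists (enorm x ^+ 2).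
have [C CE] : {C | C = enorm y ^+ 2} by exists (enorm y ^+ 2).
have [B BE] : {B | B = dot x y} by exists (dot x y).
rewrite -AE -BE -CE.
have C0 : 0 <= C by rewrite CE exprn_ge0// enorm_ge0.
have : 0 <= \sum_i (C * x ord0 i - B * y ord0 i) ^+ 2.
  by rewrite sumr_ge0// => i _; exact: sqr_ge0.
have -> : \sum_i (C * x ord0 i - B * y ord0 i) ^+ 2 = C * (A * C - B ^+ 2).
  transitivity (C ^+ 2 * \sum_i x ord0 i ^+ 2
      - 2 * C * B * \sum_i x ord0 i * y ord0 i
      + B ^+ 2 * \sum_i y ord0 i ^+ 2); last first.
    by rewrite -!sqr_enorm -/(dot x y) -AE -BE -CE; ring.
  rewrite !mulr_sumr -sumrB -big_split/=; apply: eq_bigr => i _; ring.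
move: C0; rewrite le_eqVlt => /predU1P[C0 _|C0]; last first.
  by rewrite pmulr_rge0// subr_ge0.
have y0 i : y ord0 i = 0.
  have := C0; rewrite CE sqr_enorm => /esym/eqP.
  rewrite psumr_eq0; last by move=> j _; exact: sqr_ge0.
  by move=> /allP/(_ i); rewrite mem_index_enum => /(_ isT); rewrite sqrf_eq0 => /eqP.
rewrite BE /dot big1 ?expr0n -?C0 ?mulr0// => i _.
by rewrite y0 mulr0.
Qed.

Lemma sqr_enormD x y :
  enorm (x + y) ^+ 2 = enorm x ^+ 2 + 2 * dot x y + enorm y ^+ 2.
Proof.
rewrite !sqr_enorm /dot mulr_sumr -!big_split/=; apply: eq_bigr => i _.
by rewrite mxE; ring.
Qed.

Lemma enormD x y : enorm (x + y) <= enorm x + enorm y.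
Proof.
rewrite -(@ler_pXn2r _ 2) ?nnegrE ?addr_ge0 ?enorm_ge0//.
rewrite sqr_enormD; have := cauchy_schwarz_dot x y.
by rewrite ler_norml => /andP[_ h]; nra.
Qed.

Lemma enormZ (k : R) x : enorm (k *: x) = `|k| * enorm x.
Proof.
apply/eqP; rewrite -(@eqrXn2 _ 2)// ?mulr_ge0 ?enorm_ge0//.
rewrite exprMn real_normK ?num_real// !sqr_enorm mulr_sumr.
by apply/eqP; apply: eq_bigr => i _; rewrite mxE exprMn.
Qed.

Lemma enormN x : enorm (- x) = enorm x.
Proof. by rewrite -scaleN1r enormZ normrN normr1 mul1r. Qed.

Lemma enorm_dist x y : `|enorm (x + y) - enorm x| <= enorm y.
Proof.
rewrite ler_norml lerBlDl enormD andbT.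
have := enormD (x + y) (- y); rewrite addrK enormN; lra.
Qed.

Lemma coord_le_enorm x i : `|x ord0 i| <= enorm x.
Proof.
rewrite -(@ler_pXn2r _ 2) ?nnegrE ?enorm_ge0// real_normK ?num_real//.
by rewrite sqr_enorm (bigD1 i)//= lerDl sumr_ge0// => j _; exact: sqr_ge0.
Qed.

Lemma enorm_le_coord x (m : R) : 0 <= m -> (forall i, `|x ord0 i| <= m) ->
  enorm x <= d%:R * m.
Proof.
move=> m0 xm.
rewrite -(@ler_pXn2r _ 2) ?nnegrE ?enorm_ge0 ?mulr_ge0//.
rewrite sqr_enorm exprMn.
apply: (@le_trans _ _ (\sum_(i < d) m ^+ 2)).
  apply: ler_sum => i _; rewrite -[leLHS]real_normK ?num_real//.
  by rewrite lerXn2r ?nnegrE.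
rewrite sumr_const card_ord -[leLHS]mulr_natl ler_wpM2r ?sqr_ge0// -natrX ler_nat.
by case: (d) => // n; rewrite expnS expn1 leq_pmull.
Qed.

Lemma measurable_enorm : measurable_fun [set: 'rV[R]_d] (@enorm R d).
Proof.
apply: (@measurableT_comp _ _ _ _ _ _ (@Num.sqrt R)).
  exact: continuous_measurable_fun (@sqrt_continuous R).
apply: measurable_sum => i; apply: measurable_funX.
exact: measurable_coord_rV.
Qed.

End euclidean_norm.

(** * Translation invariance of Lebesgue measure *)

Section lebesgue_translation.
Context {R : realType}.
Local Open Scope ereal_scope.

Lemma measurable_shiftr_rV d (a : 'rV[R]_d) :
  measurable_fun setT (fun x : 'rV[R]_d => x + a)%R.
Proof.
apply: measurable_fun_rV => i.
rewrite (_ : (fun _ => _) = (fun x : 'rV[R]_d => x ord0 i + a ord0 i)%R); last first.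
  by apply/funext => x; rewrite mxE.
by apply: measurable_funD => //; exact: measurable_coord_rV.
Qed.

Lemma measurable_shiftr_R (t : R) :
  measurable_fun setT ((fun s => s + t)%R : measurableTypeR R -> measurableTypeR R).
Proof. exact: measurable_funD. Qed.

(** Both sides are measures that agree on half-open intervals. *)
Lemma lebesgue_measure_shiftr (t : R) (A : set (measurableTypeR R)) :
  measurable A ->
  lebesgue_measure ((fun s => s + t)%R @^-1` A : set (measurableTypeR R)) =
  lebesgue_measure A.
Proof.
move=> mA; apply/esym.
have := @lebesgue_measure_unique R
  (measure_function_pushforward__canonical__measure_function_Measure
    lebesgue_measure (measurable_shiftr_R t)).
apply => // _ [[a b] _ <-] /=; rewrite /pushforward.
rewrite (_ : _ @^-1` _ = `](a - t)%R, (b - t)%R]%classic); last first.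
  by apply/seteqP; split => x /=; rewrite !in_itv/= ltrBlDr lerBrDr.
by rewrite !lebesgue_measure_itv/= !lte_fin ltrD2r -EFinB -EFinB opprB addrA subrK.
Qed.

Lemma consrV0 d (p : 'rV[R]_d * measurableTypeR R) :
  consrV p ord0 ord0 = p.2.
Proof.
rewrite /consrV (_ : ord0 = lshift d (ord0 : 'I_1)); last exact: val_inj.
by rewrite [LHS]row_mxEl mxE eqxx mulr1n.
Qed.

Lemma consrVS d (p : 'rV[R]_d * measurableTypeR R) i :
  consrV p ord0 (lift ord0 i) = p.1 ord0 i.
Proof.
rewrite /consrV (_ : lift _ _ = rshift 1 i); last exact: val_inj.
by rewrite [LHS]row_mxEr.
Qed.

(** Induction on the dimension: the first coordinate shifts the sections, which
    have the same length, and the others shift the variable of integration. *)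
Lemma lebesgue_rV_shiftr d (a : 'rV[R]_d) (A : set 'rV[R]_d) : measurable A ->
  lebesgue_rV d ((fun x => x + a)%R @^-1` A) = lebesgue_rV d A.
Proof.
elim: d a A => [a A mA|d IH a A mA] /=.
  congr (dirac _ _); rewrite (_ : (fun _ => _) = id)//.
  by apply/funext => x; rewrite [LHS]thinmx0 [RHS]thinmx0.
pose t : R := a ord0 ord0.
pose b : 'rV[R]_d := \row_j a ord0 (lift ord0 j).
rewrite /lebesgue_cons /pushforward.
set B := consrV (d := d) @^-1` A.
have mB : measurable B.
  by rewrite -[B]setTI; exact: measurable_consrV.
have consD (p : 'rV[R]_d * measurableTypeR R) :
    (consrV p + a = consrV ((p.1 + b)%R, (p.2 + t)%R : measurableTypeR R))%R.
  apply/rowP => i; rewrite mxE.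
  case: (unliftP ord0 i) => [j ->|->]; last by rewrite !consrV0.
  by rewrite !consrVS/= !mxE.
rewrite (_ : _ @^-1` _ = (fun p : 'rV[R]_d * measurableTypeR R =>
    ((p.1 + b)%R, (p.2 + t)%R : measurableTypeR R)) @^-1` B); last first.
  by apply/seteqP; split => p; rewrite /B /preimage/= consD.
rewrite /product_measure1.
transitivity (\int[lebesgue_rV d]_x
    ((lebesgue_measure \o xsection B) \o (fun x => x + b)%R) x).
  apply: eq_integral => x _ /=.
  rewrite -[RHS](lebesgue_measure_shiftr t)//; last exact: measurable_xsection.
have mh : measurable_fun setT (lebesgue_measure \o xsection B : 'rV[R]_d -> \bar R).
  exact: measurable_fun_xsection.
rewrite -(@ge0_integral_pushforward _ _ _ _ _ _ (measurable_shiftr_rV b)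
  (lebesgue_rV d) setT (lebesgue_measure \o xsection B))//.
apply: eq_measure_integral => [|mphi S mS _]; first exact: measurable_shiftr_rV.
exact: IH.
Qed.

End lebesgue_translation.

(** * Minorization of the autoregressive kernel *)

Section noise_lower_bound.
Context {R : realType} {d : nat}.
Implicit Types x y u v : 'rV[R]_d.
Local Open Scope ereal_scope.

Lemma measurable_enorm_le (r : R) : measurable [set x : 'rV[R]_d | (enorm x <= r)%R].
Proof.
rewrite (_ : mkset _ = enorm (d := d) @^-1` `]-oo, r]%classic); last first.
  by apply/seteqP; split => x /=; rewrite in_itv.
by rewrite -[X in measurable X]setTI; exact: measurable_enorm.
Qed.

Lemma measurable_shiftl_rV v : measurable_fun setT (fun x : 'rV[R]_d => v + x)%R.
Proof.
rewrite (_ : (fun _ => _) = (fun x => x + v)%R); first exact: measurable_shiftr_rV.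
by apply/funext => x; rewrite addrC.
Qed.

Lemma lebesgue_rV_shiftl v (A : set 'rV[R]_d) : measurable A ->
  lebesgue_rV d ((fun x => v + x)%R @^-1` A) = lebesgue_rV d A.
Proof.
move=> mA; rewrite -[RHS](lebesgue_rV_shiftr v)//.
by congr (lebesgue_rV d _); apply/seteqP; split => x; rewrite /preimage/= addrC.
Qed.

Definition cube y (s : R) : set 'rV[R]_d :=
  [set x | forall i, (`|x ord0 i - y ord0 i| <= s)%R].

Lemma cube_itv y s : cube y s =
  [set x | forall i, `[(y ord0 i - s)%R, (y ord0 i + s)%R]%classic (x ord0 i)].
Proof.
by apply/seteqP; split => x cx i; have := cx i; rewrite /= in_itv/= ler_distl.
Qed.

Lemma measurable_cube y s : measurable (cube y s).
Proof.
rewrite (_ : cube y s = \bigcap_(i in [set: 'I_d])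
    ((fun x : 'rV[R]_d => x ord0 i : R) @^-1`
      `[(y ord0 i - s)%R, (y ord0 i + s)%R]%classic)).
  apply: fin_bigcap_measurable => // i _; rewrite -[X in measurable X]setTI.
  by apply: measurable_coord_rV => //; exact: measurable_itv.
rewrite cube_itv.
by apply/seteqP; split=> [x Ax i _|x Ax i]; [exact: Ax|exact: (Ax i Logic.I)].
Qed.

Lemma lebesgue_rV_cube y s : (0 <= s)%R ->
  lebesgue_rV d (cube y s) = ((2 * s) ^+ d)%:E.
Proof.
move=> s0; rewrite cube_itv.
rewrite (@lebesgue_rV_box R d (fun i => `[(y ord0 i - s)%R, (y ord0 i + s)%R]%classic))//.
rewrite (eq_bigr (fun=> (2 * s)%:E)).
  by rewrite prodEFin prodr_const card_ord.
move=> i _; rewrite lebesgue_measure_itv/= lte_fin.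
have [_|h] := ltP; first by rewrite -EFinB; congr EFin; lra.
by congr EFin; lra.
Qed.

(** The only information about the noise density that the local part of the proof
    uses. *)
Lemma ac_component_lower_bound (mu : {measure set 'rV[R]_d -> \bar R}) :
  ac_component_positive_near0 mu ->
  exists c delta : R, [/\ (0 < c)%R, (0 < delta)%R &
    forall B, measurable B -> B `<=` [set u | (enorm u < delta)%R] ->
      c%:E * lebesgue_rV d B <= mu B].
Proof.
move=> [mu_ac [mu_s [p [muE _ [mp p0 acE] _ [c c0 /nbhs_ballP[e /= e0 pe]]]]]].
exists c, e; split => // B mB Be.
rewrite muE// acE//; apply: (@le_trans _ _ (\int[lebesgue_rV d]_(x in B) c%:E)).
  by rewrite integral_cst.
rewrite -[leLHS]adde0; apply: leeD => //.
apply: ge0_le_integral => //.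
- by move=> x _; rewrite lee_fin ltW.
- by apply/measurable_EFinP; exact: measurable_funTS.
- move=> x Bx; rewrite lee_fin; apply: pe; split => // a i.
  rewrite (ord1 a) mxE /ball/= sub0r normrN.
  exact: le_lt_trans (coord_le_enorm x i) (Be x Bx).
Qed.

End noise_lower_bound.

Section autoregressive_minorization.
Context {R : realType} {d : nat}.
Variable mu : {measure set 'rV[R]_d -> \bar R}.
Variable g : 'rV[R]_d -> 'rV[R]_d.
Variable P : R.-pker 'rV[R]_d ~> 'rV[R]_d.
Implicit Types (x y v : 'rV[R]_d) (A B : set 'rV[R]_d).
Hypothesis PE : forall x A, measurable A ->
  P x A = mu ((fun u => g x + u) @^-1` A).
Hypothesis g_le : forall x, enorm (g x) <= enorm x.
Variables c delta : R.
Hypotheses (c0 : 0 < c) (delta0 : 0 < delta).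
Hypothesis mu_ge : forall B, measurable B ->
  B `<=` [set u | enorm u < delta] -> (c%:E * lebesgue_rV d B <= mu B)%E.
Local Open Scope ereal_scope.

(** Undoing the shift by [g x] turns the lower bound on the law of the noise into
    one that no longer depends on [x]. *)
Lemma kernel_ge_lebesgue x B : measurable B ->
  (forall y, B y -> enorm (y - g x) < delta)%R ->
  c%:E * lebesgue_rV d B <= P x B.
Proof.
move=> mB Bd; rewrite PE// -(lebesgue_rV_shiftl (g x))//; apply: mu_ge.
  by rewrite -[X in measurable X]setTI; exact: measurable_shiftl_rV.
by move=> u /= /Bd; rewrite addrC addKr.
Qed.

Definition central_ball : set 'rV[R]_d := [set x | (enorm x <= delta / 3)%R].

Lemma kernel_minorization x A : central_ball x -> measurable A ->
  c%:E * lebesgue_rV d (A `&` central_ball) <= P x A.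
Proof.
move=> Ux mA.
have mAU : measurable (A `&` central_ball).
  by apply: measurableI => //; exact: measurable_enorm_le.
apply: (@le_trans _ _ (P x (A `&` central_ball))); last first.
  by apply: le_measure; rewrite ?inE//; exact: subIsetl.
apply: kernel_ge_lebesgue => // y [_ Uy].
apply: le_lt_trans (enormD _ _) _; rewrite enormN.
move: Ux Uy (g_le x) delta0; rewrite /central_ball/=; lra.
Qed.

(** Aim at the point [y] obtained by moving [g x] by at most [delta / 3] towards
    the origin; a small cube around [y] is within reach of the noise density and
    its volume does not depend on [x]. *)
Lemma kernel_contraction : exists2 kappa : R, (0 < kappa)%R &
  forall x, kappa%:E <=
    P x [set y | (enorm y <= Num.max (enorm x - delta / 6) (delta / 3))%R].
Proof.
(* half-width of a cube contained in a ball of radius [delta / 6]; [d.+1] rather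
   than [d] keeps the denominator nonzero *)
pose s := (delta / (6 * d.+1%:R))%R.
have d10 : (0 < d.+1%:R :> R)%R by [].
have s0 : (0 < s)%R by rewrite divr_gt0// mulr_gt0.
have ds : (d%:R * s <= delta / 6)%R.
  rewrite /s invfM mulrA [leRHS]mulrC mulrCA mulrA.
  rewrite [leLHS](_ : _ = delta / 6 * (d%:R / d.+1%:R))%R; last by ring.
  rewrite [leRHS](_ : _ = delta / 6 * 1)%R; last by ring.
  by rewrite ler_wpM2l ?divr_ge0 ?(ltW delta0)// ler_pdivrMr// mul1r ler_nat.
exists (c * (2 * s) ^+ d)%R.
  by rewrite mulr_gt0// exprn_gt0// mulr_gt0.
move=> x; set v := g x.
have [y [yv yv']] : exists y : 'rV[R]_d,
    (enorm (y - v) <= delta / 3 /\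
     enorm y <= Num.max (enorm v - delta / 3) 0)%R.
  have [vd|vd] := leP (enorm v) (delta / 3)%R.
    exists 0%R; rewrite sub0r enormN; split => //.
    by rewrite -(scale0r 0%R) enormZ normr0 mul0r le_max lexx orbT.
  have v0 : (0 < enorm v)%R by apply: lt_trans vd; rewrite divr_gt0.
  have t1 : (delta / 3 / enorm v <= 1)%R by rewrite ler_pdivrMr// mul1r ltW.
  have t0 : (0 <= delta / 3 / enorm v)%R by rewrite divr_ge0 ?(ltW v0)// divr_ge0// ltW.
  exists ((1 - delta / 3 / enorm v) *: v)%R; split.
    rewrite scalerBl scale1r addrAC subrr sub0r enormN enormZ ger0_norm//.
    by rewrite divfK ?gt_eqF.
  rewrite enormZ ger0_norm ?subr_ge0// mulrBl mul1r divfK ?gt_eqF//.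
  by rewrite le_max lexx.
have cubeE z : cube y s z -> (enorm (z - y) <= delta / 6)%R.
  move=> zc; apply: le_trans ds; apply: enorm_le_coord; first exact: ltW.
  by move=> i; rewrite !mxE; exact: zc.
rewrite EFinM -(lebesgue_rV_cube y (ltW s0)).
apply: (@le_trans _ _ (P x (cube y s))).
  apply: kernel_ge_lebesgue; first exact: measurable_cube.
  move=> z /cubeE zy; have := enormD (z - y)%R (y - v)%R.
  rewrite addrA subrK => h; apply: le_lt_trans h _.
  move: delta0; lra.
apply: le_measure; rewrite ?inE; [exact: measurable_cube|exact: measurable_enorm_le|].
move=> z /cubeE zy /=; have := enormD (z - y)%R y; rewrite subrK => h.
have := g_le x; rewrite -/v => vx.
have : (enorm y <= enorm v - delta / 3 \/ enorm y <= 0)%R.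
  by move: yv'; rewrite le_max => /orP[]; [left|right].
move=> yle; rewrite le_max; apply/orP.
by case: yle => yle; [left|right]; move: delta0; lra.
Qed.

Definition minorizing_measure : {measure set 'rV[R]_d -> \bar R} :=
  mscale (NngNum (ltW c0)) (mrestr (lebesgue_rV d) (measurable_enorm_le (delta / 3))).

Lemma minorizing_measureE A :
  minorizing_measure A = c%:E * lebesgue_rV d (A `&` central_ball).
Proof. by []. Qed.

Lemma minorizing_measure_gt0 : 0 < minorizing_measure setT.
Proof.
rewrite minorizing_measureE setTI mule_gt0 ?lte_fin//.
pose s := (delta / (3 * d.+1%:R))%R.
have s0 : (0 < s)%R by rewrite divr_gt0// mulr_gt0.
apply: (@lt_le_trans _ _ (lebesgue_rV d (cube 0 s))).
  by rewrite lebesgue_rV_cube ?ltW// lte_fin exprn_gt0// mulr_gt0.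
apply: le_measure; rewrite ?inE; [exact: measurable_cube|exact: measurable_enorm_le|].
move=> z zc; apply: (@le_trans _ _ (d%:R * s)%R).
  by apply: enorm_le_coord; [exact: ltW|move=> i; have := zc i; rewrite mxE subr0].
rewrite [leLHS](_ : _ = delta / 3 * (d%:R / d.+1%:R))%R; last first.
  by rewrite /s invfM; ring.
rewrite -[leRHS]mulr1.
by rewrite ler_wpM2l ?divr_ge0 ?(ltW delta0)// ler_pdivrMr// mul1r ler_nat.
Qed.

Lemma minorizing_measure_fin : minorizing_measure setT < +oo.
Proof.
rewrite minorizing_measureE setTI lte_mul_pinfty ?lee_fin ?(ltW c0)//.
apply: (@le_lt_trans _ _ (lebesgue_rV d (cube 0 (delta / 3)))).
  apply: le_measure; rewrite ?inE; [exact: measurable_enorm_le|exact: measurable_cube|].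
  move=> z zU i; rewrite mxE subr0; apply: le_trans zU; exact: coord_le_enorm.
by rewrite lebesgue_rV_cube ?ltry// divr_ge0// ltW.
Qed.

Lemma minorizing_measure_outside : minorizing_measure (~` central_ball) = 0.
Proof. by rewrite minorizing_measureE setICl measure0 mule0. Qed.

(** [n] contraction steps bring the ball of radius [M] into the central ball, where
    the next step dominates the measure.  The remaining [j] steps are carried along
    so that the bound applies to any power of the kernel. *)
Lemma uniform_minorization (M : R) : exists n (k : R), (0 < k)%R /\
  forall x, (enorm x <= M)%R -> forall A j, measurable A ->
    k%:E * \int[minorizing_measure]_y kiter P j y A <= kiter P (n.+1 + j)%N x A.
Proof.
have [kappa k0 Pk] := kernel_contraction.
have [n nM] : exists n : nat, (M <= delta / 3 + n%:R * (delta / 6))%R.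
  exists (Num.bound (`|M| / (delta / 6))).
  have := @archi_boundP R (`|M| / (delta / 6)).
  rewrite divr_ge0 ?divr_ge0 ?(ltW delta0)// => /(_ isT)/ltW.
  rewrite ler_pdivrMr ?divr_gt0// => h.
  by have := ler_norm M; move: delta0; lra.
exists n, (kappa ^+ n)%R; split; first exact: exprn_gt0.
move=> x xM; have {xM nM} : (enorm x <= delta / 3 + n%:R * (delta / 6))%R.
  exact: le_trans xM nM.
elim: n x => [|n IH] x xn A j mA.
  rewrite expr0 mul1e; apply: ge0_le_measure_integral => //; last first.
    exact: measurable_kernel.
  move=> S mS; rewrite minorizing_measureE; apply: kernel_minorization => //.
  by move: xn; rewrite mul0r addr0.
pose D := [set y : 'rV[R]_d | (enorm y <= delta / 3 + n%:R * (delta / 6))%R].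
have mD : measurable D by exact: measurable_enorm_le.
have I0 : 0 <= \int[minorizing_measure]_y kiter P j y A by exact: integral_ge0.
rewrite exprS EFinM -muleA.
apply: (@le_trans _ _ (\int[P x]_(y in D)
    ((kappa ^+ n)%:E * \int[minorizing_measure]_y kiter P j y A))).
  rewrite integral_cst// muleC; apply: lee_wpmul2l.
    by rewrite mule_ge0// lee_fin exprn_ge0// ltW.
  apply: le_trans (Pk x) _; apply: le_measure; rewrite ?inE//.
    exact: measurable_enorm_le.
  move=> y /= /le_trans; apply.
  have n0 : (0 <= n%:R :> R)%R by [].
  rewrite ge_max; apply/andP; split.
    by move: xn; rewrite -natr1; lra.
  by rewrite lerDl mulr_ge0// divr_ge0// ltW.
apply: (@le_trans _ _ (\int[P x]_(y in D) kiter P (n.+1 + j)%N y A)).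
  apply: ge0_le_integral => //.
  - by move=> y _; rewrite mule_ge0// lee_fin exprn_ge0// ltW.
  - exact: measurable_funTS (measurable_kernel _ _ _).
  - by move=> y Dy; exact: IH.
apply: ge0_subset_integral => //.
exact: measurable_kernel.
Qed.

End autoregressive_minorization.

(** * Measures transported by a kernel *)

Section measure_after_kernel.
Local Open Scope ereal_scope.
Context {d1 d2} {T1 : measurableType d1} {T2 : measurableType d2} {R : realType}.
Variables (m : {measure set T1 -> \bar R}) (k : R.-ker T1 ~> T2).

Definition mkernel (A : set T2) : \bar R := \int[m]_x k x A.

Let mkernel0 : mkernel set0 = 0.
Proof. by apply: integral0_eq => x _; rewrite measure0. Qed.

Let mkernel_ge0 A : 0 <= mkernel A.
Proof. exact: integral_ge0. Qed.

Let mkernel_sigma_additive : semi_sigma_additive mkernel.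
Proof.
move=> F mF tF mUF.
have -> : mkernel (\bigcup_n F n) = \sum_(n <oo) mkernel (F n).
  rewrite -integral_nneseries//; last by move=> n; exact: measurable_kernel.
  by apply: eq_integral => x _; rewrite measure_semi_bigcup.
by apply: is_cvg_ereal_nneg_natsum => n _; exact: mkernel_ge0.
Qed.

HB.instance Definition _ := isMeasure.Build _ _ _ mkernel
  mkernel0 mkernel_ge0 mkernel_sigma_additive.

Import HBNNSimple.

(** Stated for any measure [n] that agrees with the transported one on measurable
    sets, so that laws of random variables can be used directly. *)
Lemma ge0_integral_mkernel (n : {measure set T2 -> \bar R}) (h : T2 -> \bar R) :
  (forall A, measurable A -> n A = mkernel A) ->
  (forall y, 0 <= h y) -> measurable_fun setT h ->
  \int[n]_y h y = \int[m]_x \int[k x]_y h y.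
Proof.
move=> nE h0 mh.
pose g i : {nnsfun T2 >-> R} := nnsfun_approx measurableT mh i.
have mg i : measurable_fun setT (EFin \o g i) by exact/measurable_EFinP.
have g0 i y : 0 <= (EFin \o g i) y by rewrite lee_fin.
have ndg y : {homo (fun i => (EFin \o g i) y) : i j / (i <= j)%N >-> i <= j}.
  by move=> i j ij; rewrite lee_fin; exact/lefP/nd_nnsfun_approx.
have gh y : limn (fun i => (EFin \o g i) y) = h y.
  by apply/cvg_lim => //; exact: cvg_nnsfun_approx.
have intE (p : {measure set T2 -> \bar R}) :
    \int[p]_y h y = limn (fun i => \int[p]_y (g i y)%:E).
  rewrite -monotone_convergence//; last first.
  - by move=> y _; exact: ndg.
  - by move=> i y _; exact: g0.
  by apply: eq_integral => y _; rewrite gh.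
have mint i : measurable_fun setT (fun x => \int[k x]_y (g i y)%:E).
  apply: measurable_fun_integral_kernel => //; first exact: measurable_kernel.
  - by move=> y; exact: g0.
  - exact: mg.
rewrite intE; under [RHS]eq_integral do rewrite intE.
rewrite monotone_convergence//; last 2 first.
- by move=> i x _; apply: integral_ge0 => y _; exact: g0.
- move=> x _ i j ij; apply: ge0_le_integral => //; do ?exact: mg.
  - by move=> y _; exact: g0.
  - by move=> y _; exact: ndg.
apply: congr_lim; apply/funext => i.
rewrite integralT_nnsfun sintegralE.
under [RHS]eq_integral do rewrite integralT_nnsfun sintegralE.
have mr r : measurable_fun setT (fun x => r%:E * k x (g i @^-1` [set r])).
  by apply: measurable_funeM; exact: measurable_kernel.
rewrite ge0_integral_fsum//; last by move=> r x _; exact: nnsfun_mulemu_ge0.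
apply: eq_fsbigr => r rg; rewrite nE// /mkernel.
rewrite ge0_integralZl//; first exact: measurable_kernel.
by move: rg; rewrite inE => -[y _ <-]; rewrite lee_fin.
Qed.

End measure_after_kernel.

(** * Irreducibility, aperiodicity and petite sets from a minorization *)

Lemma ordS_fixed n (i : 'I_n) : ordS i = i -> n = 1%N.
Proof.
case: i => i /= lt_in /(congr1 val)/=; move: (lt_in).
rewrite leq_eqVlt => /predU1P[iE|ilt]; last first.
  by rewrite modn_small// => /eqP; rewrite gtn_eqF.
by rewrite iE modnn => i0; rewrite -iE -i0.
Qed.

Section irreducibility.
Local Open Scope ereal_scope.
Context {R : realType} {dT : measure_display} {T : measurableType dT}.
Variable P : R.-pker T ~> T.
Variable nu : {measure set T -> \bar R}.
Hypotheses (nu_pos : 0 < nu setT) (nu_finite : nu setT < +oo).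

Lemma kiter0 x A : kiter P 0 x A = \d_x A.
Proof. by []. Qed.

Lemma measurable_kiter n A : measurable A -> measurable_fun setT (fun x => kiter P n x A).
Proof. by move=> mA; exact: measurable_kernel. Qed.

Lemma finite_measure_sigma_finite (m : {measure set T -> \bar R}) :
  m setT < +oo -> exists s : {sigma_finite_measure set T -> \bar R}, forall A, s A = m A.
Proof.
move=> mfin; pose s : {finite_measure set T -> \bar R} := mfrestr measurableT mfin.
by exists s => A; rewrite /s/= /mfrestr /mrestr setIT.
Qed.

(** Otherwise the sum over [n] of [P^n(y, A)], which is positive everywhere, would
    vanish almost everywhere for a nonzero measure. *)
Lemma integral_kiter_gt0 A : measurable A ->
  (forall x, exists n, 0 < kiter P n x A) ->
  exists n, 0 < \int[nu]_y kiter P n y A.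
Proof.
move=> mA Apos; apply: contrapT => /forallNP hn.
have h0 n : \int[nu]_y kiter P n y A = 0.
  apply/eqP; rewrite eq_le integral_ge0// andbT leNgt; exact/negP/hn.
have mH : measurable_fun setT (fun y => \sum_(n <oo) kiter P n y A).
  by apply: ge0_emeasurable_sum => // n _; exact: measurable_kiter.
have : ae_eq nu setT (fun y => \sum_(n <oo) kiter P n y A) (cst 0).
  apply/ae_eq_integral_abs => //.
  under eq_integral do rewrite gee0_abs ?nneseries_ge0//.
  rewrite integral_nneseries//; last by move=> n; exact: measurable_kiter.
  by rewrite eseries0.
move=> [N [mN N0 NP]].
suff NT : N = setT by move: nu_pos; rewrite -NT N0 ltxx.
apply/seteqP; split => // x _; apply: NP => /= /(_ Logic.I) H0.
have [n] := Apos x; apply/negP; rewrite -leNgt -H0.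
apply: le_trans (nneseries_lim_ge n.+1 _); last by [].
rewrite big_nat_recr//= leeDr// sume_ge0//.
Qed.

Section minorized.
Hypothesis minor : forall x, exists n (k : R), (0 < k)%R /\
  forall A j, measurable A ->
    k%:E * \int[nu]_y kiter P j y A <= kiter P (n.+1 + j)%N x A.

Lemma kiter_gt0_of_integral x A j : measurable A ->
  0 < \int[nu]_y kiter P j y A -> exists2 n, (0 < n)%N & 0 < kiter P n x A.
Proof.
move=> mA h; have [n [k [k0 /(_ A j mA) hk]]] := minor x.
exists (n.+1 + j)%N; first by rewrite addSn.
by apply: lt_le_trans hk; rewrite mule_gt0.
Qed.

Lemma irreducibility_measure_minorizing (s : {sigma_finite_measure set T -> \bar R}) :
  (forall A, s A = nu A) -> irreducibility_measure P s.
Proof.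
move=> sE; split; first by rewrite sE.
move=> A mA; rewrite sE => nuA x; apply: (@kiter_gt0_of_integral x A 0%N) => //.
rewrite (eq_integral (fun y => (\1_A y)%:E)) ?integral_indic ?setIT//.
Qed.

Let weight_ge0 n : (0 <= 2 ^- n.+1 :> R)%R.
Proof. by rewrite invr_ge0 exprn_ge0. Qed.

(** The measure [nu] run through the chain for a geometric time; this is the
    candidate for the maximal irreducibility measure. *)
Definition resolvent_measure : {measure set T -> \bar R} :=
  mseries (fun n => mscale (NngNum (weight_ge0 n)) (mkernel nu (kiter P n))) 0.

Lemma resolvent_measureE A :
  resolvent_measure A = \sum_(n <oo) (2 ^- n.+1)%:E * \int[nu]_y kiter P n y A.
Proof. by []. Qed.

Lemma resolvent_measure_fin : resolvent_measure setT < +oo.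
Proof.
have nuf : nu setT \is a fin_num by rewrite ge0_fin_numE.
have /le_lt_trans : resolvent_measure setT <=
    \sum_(0 <= n <oo) (0 + (fine (nu setT) / (2 ^ n.+1)%:R)%:E).
  rewrite resolvent_measureE; apply: lee_nneseries => n.
    by rewrite mule_ge0// integral_ge0.
  move=> _; rewrite add0e mulrC EFinM natrX lee_wpmul2l// fineK//.
  rewrite -[leRHS]mul1e -integral_cst//; apply: ge0_le_integral => //.
    exact: measurable_kiter.
  by move=> y _; exact: sprob_kernel_le1.
apply; apply: le_lt_trans (epsilon_trick xpredT _ _) _ => //.
by rewrite eseries0// add0e ltry.
Qed.

(** A set charged by [resolvent_measure] is charged by some [nu P^j], hence reached
    from everywhere.  Conversely, a set that is charged by some irreducibility
    measure is reached from every point, so some [nu P^n] charges it. *)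
Lemma minorized_psi_irreducible : psi_irreducible P.
Proof.
have [psi psiE] := finite_measure_sigma_finite resolvent_measure_fin.
exists psi; split.
  split.
    rewrite psiE resolvent_measureE.
    apply: (@lt_le_trans _ _
        (\sum_(0 <= n < 1) (2 ^- n.+1)%:E * \int[nu]_y kiter P n y setT)).
      rewrite big_nat1 mule_gt0 ?lte_fin//.
      rewrite (eq_integral (fun=> 1)) ?integral_cst ?mul1e// => y _.
      by rewrite kiter0 diracT.
    by apply: nneseries_lim_ge => n _ _; rewrite mule_ge0// integral_ge0.
  move=> A mA psiA x.
  have [j hj] : exists j, 0 < \int[nu]_y kiter P j y A.
    apply: contrapT => /forallNP hn; move: psiA.
    rewrite psiE resolvent_measureE eseries0 ?ltxx// => n _ _.
    suff -> : \int[nu]_y kiter P n y A = 0 by rewrite mule0.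
    by apply/eqP; rewrite eq_le integral_ge0// andbT leNgt; exact/negP/hn.
  exact: kiter_gt0_of_integral hj.
move=> phi [_ phiP] N psiN B mB BN.
apply/eqP; rewrite eq_le measure_ge0 andbT leNgt; apply/negP => phiB.
have [n hn] : exists n, 0 < \int[nu]_y kiter P n y B.
  apply: integral_kiter_gt0 => // x.
  by have [n _ ?] := phiP _ mB phiB x; exists n.
have : 0 < psi B.
  rewrite psiE resolvent_measureE.
  have w0 i : 0 <= (2 ^- i.+1)%:E * \int[nu]_y kiter P i y B.
    by rewrite mule_ge0// integral_ge0.
  apply: lt_le_trans (nneseries_lim_ge n.+1 _); last by [].
  rewrite big_nat_recr//= (@lt_le_trans _ _ ((2 ^- n.+1)%:E * \int[nu]_y kiter P n y B))//.
    by rewrite mule_gt0// lte_fin.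
  by rewrite leeDr// sume_ge0.
by rewrite psiN// ltxx.
Qed.

(** Some class [D i] of a cycle meets [U] in a set charged by [nu].  From a point of
    that intersection the chain moves to the next class with probability one, and
    also to [D i] with positive probability, so both classes coincide. *)
Lemma minorized_aperiodic (psi : {sigma_finite_measure set T -> \bar R}) (U : set T) :
  measurable U -> nu (~` U) = 0 ->
  (forall x A, U x -> measurable A -> nu A <= P x A) ->
  maximal_irreducibility_measure P psi -> aperiodic P psi.
Proof.
move=> mU nuU PU [_ psimax] n D n0 [mD tD DP Dcover].
have [s sE] := finite_measure_sigma_finite nu_finite.
have nuC : nu (~` \bigcup_i D i) = 0.
  rewrite -sE; apply: (psimax s (irreducibility_measure_minorizing sE) (~` \bigcup_i D i)).
  - apply/measure0_null_setP => //; apply: measurableC.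
    by apply: fin_bigcup_measurable => // i _; exact: mD.
  - by apply: measurableC; apply: fin_bigcup_measurable => // i _; exact: mD.
  - by [].
have [i nuDi] : exists i, 0 < nu (D i `&` U).
  apply: contrapT => /forallNP h.
  have DU0 i : nu (D i `&` U) = 0.
    by apply/eqP; rewrite eq_le measure_ge0 andbT leNgt; exact/negP/h.
  move: nu_pos; apply/negP; rewrite -leNgt.
  have mC : measurable (\bigcup_i D i).
    by apply: fin_bigcup_measurable => // i _; exact: mD.
  have mDU i : measurable (D i `&` U) by exact: measurableI.
  have Usub : U `<=` ~` (\bigcup_i D i) `|` \bigcup_i (D i `&` U).
    move=> x Ux; have [[j _ Djx]|?] := pselect ((\bigcup_i D i) x); last by left.
    by right; exists j.
  have nuDU : nu (\bigcup_i (D i `&` U)) = 0.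
    apply/eqP; rewrite eq_le measure_ge0 andbT.
    apply: (@le_trans _ _ (\sum_(i \in [set: 'I_n]) nu (D i `&` U))).
      apply: content_sub_fsum => //.
      exact: finite_finset.
      exact: fin_bigcup_measurable.
    by rewrite fsbig1.
  have mE : measurable (\bigcup_i (D i `&` U)) by apply: fin_bigcup_measurable.
  rewrite -(setvU U); apply: (@le_trans _ _ (nu (~` U) + nu U)).
    by apply: measureU2 => //; exact: measurableC.
  rewrite nuU add0e.
  apply: (@le_trans _ _ (nu (~` (\bigcup_i D i) `|` \bigcup_i (D i `&` U)))).
    apply: le_measure => //; rewrite inE//.
    by apply: measurableU => //; exact: measurableC.
  apply: (@le_trans _ _ (nu (~` (\bigcup_i D i)) + nu (\bigcup_i (D i `&` U)))).
    by apply: measureU2 => //; exact: measurableC.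
  by rewrite nuC nuDU adde0.
have [x [Dix Ux]] : (D i `&` U) !=set0.
  by apply/set0P/eqP => DU0; move: nuDi; rewrite DU0 measure0 ltxx.
have Pi : 0 < P x (D i).
  apply: lt_le_trans (PU x (D i) Ux (mD i)); apply: lt_le_trans nuDi _.
  by apply: le_measure; rewrite ?inE//; exact: measurableI.
have Pnext : P x (D (ordS i)) = 1 := DP i x Dix.
have [/ordS_fixed//|iE] := eqVneq (ordS i) i.
exfalso.
have : P x (D (ordS i)) + P x (D i) <= 1.
  rewrite -measureU//; last first.
    by move/trivIsetP : tD => /(_ (ordS i) i Logic.I Logic.I iE).
  rewrite -(@prob_kernel _ _ _ _ _ P x); apply: le_measure; rewrite ?inE//.
  exact: measurableU.
rewrite Pnext -[leRHS]adde0 leeD2lE// => /(lt_le_trans Pi).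
by rewrite ltxx.
Qed.

End minorized.
End irreducibility.

Section minorized_set.
Local Open Scope ereal_scope.
Context {R : realType} {dT : measure_display} {T : measurableType dT}.
Variable P : R.-pker T ~> T.
Variable nu : {measure set T -> \bar R}.
Hypotheses (nu_pos : 0 < nu setT) (nu_finite : nu setT < +oo).
Variables (C : set T) (n : nat) (k : R).
Hypotheses (mC : measurable C) (k0 : (0 < k)%R).
Hypothesis minorC : forall x, C x -> forall A j, measurable A ->
  k%:E * \int[nu]_y kiter P j y A <= kiter P (n.+1 + j)%N x A.

(** The sampling distribution is the point mass at [n.+1]. *)
Lemma minorized_petite : petite P C.
Proof.
split => //; exists (fun i => (i == n.+1)%:R), (mscale (NngNum (ltW k0)) nu).
have sumE (h : nat -> \bar R) : (forall i, 0 <= h i) ->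
    \sum_(i <oo) ((i == n.+1)%:R)%:E * h i = h n.+1.
  move=> h0; rewrite (@nneseriesD1 _ _ n.+1)//; last by move=> i _; rewrite mule_ge0.
  rewrite eqxx mul1e eseries0 ?adde0// => i _ /=.
  by move=> /negbTE ->; rewrite mul0e.
split.
- by move=> i.
- by under eq_eseriesr do rewrite -[_%:E]mule1; rewrite sumE.
- by rewrite /mscale/= mule_gt0.
move=> x B Cx mB; rewrite sumE//.
have := minorC Cx 0%N mB; rewrite addn0; apply: le_trans.
by rewrite /mscale/= (eq_integral (fun y => (\1_B y)%:E)) ?integral_indic ?setIT.
Qed.

Lemma minorized_reaches B : measurable B ->
  (forall x, exists n, 0 < kiter P n x B) ->
  exists N (p : R), [/\ (0 < N)%N, (0 < p)%R &
    forall x, C x -> p%:E <= kiter P N x B].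
Proof.
move=> mB Bpos.
have [j hj] := integral_kiter_gt0 nu_pos mB Bpos.
have Ifin : \int[nu]_y kiter P j y B \is a fin_num.
  rewrite ge0_fin_numE ?integral_ge0//; apply: le_lt_trans nu_finite.
  rewrite -[leRHS]mul1e -integral_cst//; apply: ge0_le_integral => //.
    exact: measurable_kiter.
  move=> y _; apply: le_trans (sprob_kernel_le1 (kiter P j) y).
  by apply: le_measure; rewrite ?inE.
exists (n.+1 + j)%N, (k * fine (\int[nu]_y kiter P j y B))%R; split => //.
  by rewrite mulr_gt0// fine_gt0// hj ltey_eq Ifin.
by move=> x Cx; rewrite EFinM fineK//; exact: minorC.
Qed.
End minorized_set.

(** * The drift inequality *)

Section power_estimates.
Context {R : realType}.

Lemma ler_powRn (a b p : R) : 0 < b -> b <= a -> p <= 0 -> a `^ p <= b `^ p.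
Proof.
move=> b0 ba p0; have a0 := lt_le_trans b0 ba.
rewrite -[p]opprK !(powRN _ (- p)) lef_pV2 ?posrE ?powR_gt0//.
by apply: ge0_ler_powR; rewrite ?nnegrE ?oppr_ge0// ltW.
Qed.

Lemma powR_unbounded (p M : R) : 0 < p ->
  exists2 S : R, 1 <= S & forall s, S <= s -> M <= s `^ p.
Proof.
move=> p0; exists (Num.max 1 (`|M| `^ p^-1)); first by rewrite le_max lexx.
move=> s; rewrite ge_max => /andP[s1 Ms].
apply: le_trans (ler_norm M) _.
have -> : `|M| = (`|M| `^ p^-1) `^ p by rewrite -powRrM mulVf ?gt_eqF// powRr1.
by apply: ge0_ler_powR; rewrite ?nnegrE ?powR_ge0// ?(ltW p0)// (le_trans _ s1).
Qed.

Lemma expRN_le (t : R) : 0 <= t <= 1 -> expR (- t) <= 1 - t / 2.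
Proof.
move=> /andP[t0 t1]; have := expR_ge1Dx t => h.
rewrite expRN -[leLHS]mul1r ler_pdivrMr ?expR_gt0//.
apply: (@le_trans _ _ ((1 - t / 2) * (1 + t))); first by nra.
by rewrite ler_wpM2l//; lra.
Qed.

(** Here [s = |x|], [v = |g x|] and [h = s^(theta - rho)].  The contraction yields
    [v^theta <= s^theta - theta r0 h], worth a factor [exp (- 2 t)] with
    [t = z theta r0 h / 2]; the hypotheses on [z] and [s] make the noise terms
    together at most [t], so that [exp (- 2 t) (1 + t) <= exp (- t) <= 1 - t / 2]. *)
Lemma drift_numeric (z theta rho r0 K s v : R) :
  0 < z -> 0 < theta <= 1 -> theta < rho -> theta <= 2 - rho -> 0 < r0 -> 0 < K ->
  1 <= s -> s / 2 <= v -> v <= s * (1 - r0 * s `^ (- rho)) ->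
  4 * K * z <= theta * r0 / 4 -> z * theta * r0 / 2 <= 1 ->
  16 * K / (theta * r0) <= s `^ (2 - rho) ->
  expR (z * v `^ theta) *
    (1 + K * z * v `^ (theta - 2) + K * z ^+ 2 * v `^ (2 * (theta - 1))) <=
  expR (z * s `^ theta) * (1 - z * theta * r0 / 4 * s `^ (theta - rho)).
Proof.
move=> z0 /andP[th0 th1] thrho th2 r00 K0 s1 sv vs zK zr sbig.
have s0 : 0 < s by lra.
have v0 : 0 < v by lra.
set h := s `^ (theta - rho).
have h0 : 0 < h by exact: powR_gt0.
have h1 : h <= 1.
  by rewrite -(powRr0 s); apply: ler_powR => //; rewrite subr_le0 ltW.
have H1 : v `^ theta <= s `^ theta - theta * r0 * h.
  apply: le_trans (powR_le_tangent (ltW v0) s0 _) _; first by rewrite (ltW th0).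
  rewrite lerD2l -lerN2 opprK -mulrN opprB -mulrA -mulrA ler_pM2l//.
  have -> : r0 * h = s `^ (theta - 1) * (s * (r0 * s `^ (- rho))).
    rewrite gt0_powRB1// /h gt0_powRD//; field; exact: lt0r_neq0.
  by rewrite ler_pM2l ?powR_gt0//; lra.
have P4 p : - 2 <= p -> p <= 0 -> v `^ p <= 4 * s `^ p.
  move=> p2 p0; apply: (@le_trans _ _ ((s / 2) `^ p)).
    by apply: ler_powRn => //; rewrite divr_gt0.
  rewrite powRM ?invr_ge0 ?(ltW s0)// mulrC ler_wpM2r ?powR_ge0//.
  have -> : (2^-1 : R) = 2 `^ (-1) by rewrite powR_inv1.
  rewrite -powRrM mulN1r.
  apply: (@le_trans _ _ (2 `^ 2)); first by apply: ler_powR; lra.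
  by rewrite (powR_mulrn 2)//; lra.
have H2 : K * z * v `^ (theta - 2) <= z * (theta * r0 / 4) * h.
  apply: (@le_trans _ _ (K * z * (4 * s `^ (theta - 2)))).
    by rewrite ler_wpM2l ?mulr_ge0 ?(ltW K0) ?(ltW z0)// P4; lra.
  have -> : s `^ (theta - 2) = h / s `^ (2 - rho).
    rewrite -powRN /h -gt0_powRD//; congr (_ `^ _); ring.
  set u := s `^ (2 - rho).
  have u0 : 0 < u by exact: powR_gt0.
  rewrite -/u ler_pdivrMr ?mulr_gt0// in sbig.
  rewrite [leLHS](_ : _ = z * h * (4 * K / u)); last by ring.
  rewrite [leRHS](_ : _ = z * h * (theta * r0 / 4)); last by ring.
  rewrite ler_pM2l ?mulr_gt0// ler_pdivrMr//; lra.
have H3 : K * z ^+ 2 * v `^ (2 * (theta - 1)) <= z * (theta * r0 / 4) * h.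
  apply: (@le_trans _ _ (K * z ^+ 2 * (4 * h))).
    apply: ler_wpM2l; first by apply: mulr_ge0; [exact: ltW|exact: sqr_ge0].
    apply: (@le_trans _ _ (4 * s `^ (2 * (theta - 1)))); first by apply: P4; lra.
    by rewrite ler_pM2l// /h; apply: ler_powR => //; lra.
  rewrite [leLHS](_ : _ = z * h * (4 * K * z)); last by ring.
  rewrite [leRHS](_ : _ = z * h * (theta * r0 / 4)); last by ring.
  by rewrite ler_pM2l ?mulr_gt0.
set t := z * theta * r0 / 2 * h.
have t0 : 0 <= t by rewrite /t !mulr_ge0 ?(ltW h0)// ltW.
have t1 : t <= 1.
  by apply: le_trans zr; rewrite /t ler_piMr// !mulr_ge0// ltW.
apply: (@le_trans _ _ (expR (z * s `^ theta) * (expR (- (2 * t)) * (1 + t)))).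
  rewrite mulrA -expRD; apply: ler_pM; rewrite ?expR_ge0//.
  - by rewrite -addrA addr_ge0// addr_ge0// mulr_ge0 ?powR_ge0// ?mulr_ge0// ?sqr_ge0// ltW.
  - rewrite ler_expR /t.
    apply: (@le_trans _ _ (z * (s `^ theta - theta * r0 * h))); first by rewrite ler_pM2l.
    by rewrite le_eqVlt; apply/orP; left; apply/eqP; field.
  - by rewrite /t; lra.
rewrite ler_pM2l ?expR_gt0//.
apply: (@le_trans _ _ (expR (- t))).
  have -> : - (2 * t) = - t + - t by ring.
  rewrite expRD -mulrA -[leRHS]mulr1 ler_pM2l ?expR_gt0//.
  rewrite expRN mulrC ler_pdivrMr ?expR_gt0// mul1r.
  exact: expR_ge1Dx.
apply: le_trans (expRN_le _) _; first by rewrite t0.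
by rewrite /t; lra.
Qed.

End power_estimates.

Section exponential_weight.
Context {R : realType} {dT : measure_display} {T : measurableType dT}.
Variable e : T -> R.

Definition exp_weight (a theta : R) (x : T) : R := expR (a * e x `^ theta).

Lemma exp_weight_ge0 a theta x : 0 <= exp_weight a theta x.
Proof. exact: expR_ge0. Qed.

Lemma exp_weight_ge1 a theta x : 0 <= a -> 1 <= exp_weight a theta x.
Proof. by move=> a0; rewrite -[leLHS]expR0 ler_expR mulr_ge0 ?powR_ge0. Qed.

Lemma exp_weightD a b theta x :
  exp_weight (a + b) theta x = exp_weight a theta x * exp_weight b theta x.
Proof. by rewrite /exp_weight mulrDl expRD. Qed.

Lemma measurable_exp_weight a theta : measurable_fun setT e ->
  measurable_fun setT (exp_weight a theta).
Proof.
move=> me; apply: measurableT_comp; first exact: measurable_expR.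
by apply: measurable_funM => //; exact: (measurableT_comp (measurable_powR theta) me).
Qed.

End exponential_weight.

Section exponential_increment.
Context {R : realType} {d : nat}.
Implicit Types x y e : 'rV[R]_d.

Lemma powR_enormD y e (theta : R) : 0 <= theta <= 1 ->
  enorm (y + e) `^ theta <= enorm y `^ theta + enorm e `^ theta.
Proof.
move=> th; apply: le_trans (powR_subadd (enorm_ge0 y) (enorm_ge0 e) th).
by case/andP: th => th _; apply: ge0_ler_powR; rewrite ?nnegrE ?addr_ge0 ?enorm_ge0 ?enormD.
Qed.

(** Write [a] for the increment of [|.|^theta] and use [exp u <= 1 + u + u^2 exp |u|]
    with [u = z a].  The linear term is bounded through the tangent to the concave
    map [w |-> w^(theta / 2)] at [|y|^2], which leaves an expression that is
    quadratic in [e] without any truncation; the quadratic term is bounded through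
    the two estimates [|a| <= |y|^(theta - 1) |e|] and [|a| <= |e|^theta]. *)
Lemma expR_enormD_le y e (z theta : R) : 0 <= z -> 0 <= theta <= 1 -> 0 < enorm y ->
  expR (z * enorm (y + e) `^ theta) <= expR (z * enorm y `^ theta) *
    (1 + z * (theta / 2) * enorm y `^ (theta - 2) * (2 * dot y e + enorm e ^+ 2)
     + z ^+ 2 * enorm y `^ (2 * (theta - 1)) *
       (enorm e ^+ 2 * expR (z * enorm e `^ theta))).
Proof.
move=> z0 th y0; have /andP[th0 th1] := th.
pose a := enorm (y + e) `^ theta - enorm y `^ theta.
have -> : z * enorm (y + e) `^ theta = z * enorm y `^ theta + z * a.
  by rewrite /a; ring.
rewrite expRD ler_pM2l ?expR_gt0//.
apply: le_trans (expR_le_quadratic _) _.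
have sq (w p : R) : 0 <= w -> w `^ p = (w ^+ 2) `^ (p / 2).
  by move=> w0; rewrite -powR_mulrn// -powRrM; congr (_ `^ _); field.
have a1 : a <= theta / 2 * enorm y `^ (theta - 2) * (2 * dot y e + enorm e ^+ 2).
  have := @powR_le_tangent _ (enorm (y + e) ^+ 2) (enorm y ^+ 2) (theta / 2).
  rewrite -!sq ?enorm_ge0// => /(_ (sqr_ge0 _) (exprn_gt0 _ y0)).
  have -> : theta / 2 - 1 = (theta - 2) / 2 by field.
  rewrite -sq ?enorm_ge0// sqr_enormD => h.
  have /h : 0 <= theta / 2 <= 1 by apply/andP; split; lra.
  by rewrite /a; set b := enorm (y + e) `^ _; nra.
have a2 : `|a| <= enorm e `^ theta.
  rewrite /a ler_norml lerBlDl powR_enormD// andbT lerBrDl.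
  have := powR_enormD (y + e) (- e) th; rewrite addrK enormN.
  by move=> h; lra.
have a3 : `|a| <= enorm y `^ (theta - 1) * enorm e.
  apply: le_trans (powR_dist_le (enorm_ge0 _) y0 th) _.
  by rewrite ler_wpM2l ?powR_ge0// enorm_dist.
rewrite -!addrA lerD2l; apply: lerD.
  by apply: le_trans (ler_wpM2l z0 a1) _; rewrite !mulrA.
rewrite exprMn -[leLHS]mulrA -[leRHS]mulrA; apply: ler_wpM2l; first exact: sqr_ge0.
rewrite mulrA; apply: ler_pM; rewrite ?sqr_ge0 ?expR_ge0//.
  rewrite -[leLHS]real_normK ?num_real//.
  have -> : enorm y `^ (2 * (theta - 1)) = (enorm y `^ (theta - 1)) ^+ 2.
    by rewrite -powR_mulrn ?powR_ge0// -powRrM mulrC.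
  by rewrite -exprMn lerXn2r ?nnegrE// mulr_ge0 ?powR_ge0 ?enorm_ge0.
by rewrite ler_expR normrM ger0_norm// ler_wpM2l.
Qed.

(** One half of the exponential moment pays for the factor [1 + |e|^2], the other
    half for the remaining exponential. *)
Lemma moment_dominates (z0 gamma0 : R) : 0 < z0 -> 0 < gamma0 ->
  exists2 K : R, 0 < K & forall e (z theta : R),
    0 <= z <= z0 / 2 -> 0 <= theta <= gamma0 ->
    (1 + enorm e ^+ 2) * expR (z * enorm e `^ theta) <= K * expR (z0 * enorm e `^ gamma0).
Proof.
move=> z00 g0.
have z02 : 0 < z0 / 2 by rewrite divr_gt0.
have [K K0 hK] := powR_le_expR g0 z02 (ler0n R 2).
exists ((1 + K) * expR (z0 / 2)); first by rewrite mulr_gt0 ?expR_gt0// addr_gt0.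
move=> e z theta /andP[zp zz] /andP[th0 thg].
set t := enorm e; have t0 : 0 <= t by exact: enorm_ge0.
have E1 : 1 <= expR (z0 / 2 * t `^ gamma0).
  by rewrite -[leLHS]expR0 ler_expR mulr_ge0 ?powR_ge0 ?(ltW z02).
have H1 : 1 + t ^+ 2 <= (1 + K) * expR (z0 / 2 * t `^ gamma0).
  by rewrite mulrDl mul1r lerD// -powR_mulrn// hK.
have H2 : expR (z * t `^ theta) <= expR (z0 / 2) * expR (z0 / 2 * t `^ gamma0).
  rewrite -expRD ler_expR -[X in _ <= X + _]mulr1 -mulrDr.
  apply: ler_pM => //; first exact: powR_ge0.
  have [t1|t1] := leP t 1.
    by apply: ler_wpDr; rewrite ?powR_ge0// powR_le1// t0.
  by apply: ler_wpDl => //; apply: ler_powR => //; exact: ltW.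
apply: le_trans (ler_pM _ _ H1 H2) _; rewrite ?expR_ge0 ?addr_ge0 ?sqr_ge0//.
rewrite mulrACA mulrAC [leLHS](_ : _ = (1 + K) * expR (z0 / 2) *
   (expR (z0 / 2 * t `^ gamma0) * expR (z0 / 2 * t `^ gamma0))); last by ring.
by rewrite -expRD -mulrDl -splitr.
Qed.

End exponential_increment.

Section integrated_drift.
Context {R : realType} {d : nat} {dO : measure_display} {Omega : measurableType dO}.
Variables (Pr : probability Omega R) (X : {RV Pr >-> 'rV[R]_d}).
Variables (z0 gamma0 : R).
Hypotheses (z00 : 0 < z0) (gamma00 : 0 < gamma0 <= 1).
Hypotheses (X0 : zero_mean X) (Xmom : subexponential_moment z0 gamma0 X).
Local Open Scope ereal_scope.

Let D (w : Omega) : R := expR (z0 * enorm (X w) `^ gamma0).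

Lemma measurable_enorm_shift (y : 'rV[R]_d) :
  measurable_fun setT (fun w => enorm (y + X w)%R).
Proof.
apply: (measurableT_comp measurable_enorm).
exact: (measurableT_comp (measurable_shiftl_rV y)).
Qed.

Lemma measurable_expR_enorm_shift (y : 'rV[R]_d) (z theta : R) :
  measurable_fun setT (fun w => (expR (z * enorm (y + X w)%R `^ theta))%:E).
Proof.
apply/measurable_EFinP; apply: measurableT_comp; first exact: measurable_expR.
apply: measurable_funM => //.
exact: (measurableT_comp (measurable_powR theta) (measurable_enorm_shift y)).
Qed.

Let mD : measurable_fun setT D.
Proof.
have := measurable_expR_enorm_shift 0%R z0 gamma0 => /measurable_EFinP.
by under eq_fun do rewrite add0r.
Qed.

Let iD : Pr.-integrable setT (EFin \o D).
Proof.
apply/integrableP; split; first exact/measurable_EFinP.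
by under eq_integral do rewrite /= ger0_norm ?expR_ge0//.
Qed.

Let ED : R := fine (\int[Pr]_w (D w)%:E).

Let EDE : \int[Pr]_w (D w)%:E = ED%:E.
Proof. by rewrite fineK//; exact: integrable_fin_num. Qed.

Let ED1 : (1 <= ED)%R.
Proof.
rewrite -lee_fin -EDE -(@probability_setT _ _ _ Pr) -[leLHS]mul1e -integral_cst//.
apply: ge0_le_integral => //; first exact/measurable_EFinP.
by move=> w _; rewrite lee_fin -[leLHS]expR0 ler_expR mulr_ge0 ?powR_ge0// ltW.
Qed.

Lemma dot_zero_mean (y : 'rV[R]_d) :
  Pr.-integrable setT (fun w => (dot y (X w))%:E) /\ \int[Pr]_w (dot y (X w))%:E = 0.
Proof.
have iX i : Pr.-integrable setT (fun w => (y ord0 i * X w ord0 i)%:E).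
  by under eq_fun do rewrite EFinM; apply: integrableZl => //; exact: (X0 i).1.
have dE w : (dot y (X w))%:E = \sum_i (y ord0 i * X w ord0 i)%:E.
  by rewrite sumEFin.
split.
  by under eq_fun do rewrite dE; apply: integrable_sum.
under eq_integral do rewrite dE.
rewrite integral_sum// big1// => i _.
under eq_integral do rewrite EFinM.
rewrite integralZl//; last exact: (X0 i).1.
by have := (X0 i).2; rewrite unlock => ->; rewrite mule0.
Qed.

(** The first bound is crude and is meant for small [y]; the second keeps the
    cancellation of the linear term [<y, X>]. *)
Lemma integrated_drift : exists2 K : R, (1 <= K)%R &
  forall (y : 'rV[R]_d) (z theta : R), (0 <= z <= z0 / 2)%R -> (0 <= theta <= gamma0)%R ->
  \int[Pr]_w (expR (z * enorm (y + X w)%R `^ theta))%:E <=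
    (expR (z * enorm y `^ theta) * K)%:E /\
  ((0 < enorm y)%R ->
   \int[Pr]_w (expR (z * enorm (y + X w)%R `^ theta))%:E <=
    (expR (z * enorm y `^ theta) *
     (1 + K * z * enorm y `^ (theta - 2) +
      K * z ^+ 2 * enorm y `^ (2 * (theta - 1))))%:E).
Proof.
have [K K0 hK] := @moment_dominates R d z0 gamma0 z00 (andP gamma00).1.
exists (1 + K * ED)%R.
  by rewrite lerDl mulr_ge0 ?(ltW K0)// (le_trans _ ED1).
move=> y z theta hz hth.
have z_ge0 : (0 <= z)%R by case/andP: hz.
have th01 : (0 <= theta <= 1)%R.
  by case/andP: hth => -> /le_trans; apply; case/andP: gamma00.
have [th0 th1] := andP th01.
have mF := measurable_expR_enorm_shift y z theta.
have e1 w : (1 <= expR (z * enorm (X w) `^ theta))%R.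
  by rewrite -[leLHS]expR0 ler_expR mulr_ge0 ?powR_ge0.
have s0 w : (0 <= enorm (X w) ^+ 2)%R by exact: sqr_ge0.
split=> [|y0].
  apply: (@le_trans _ _ (\int[Pr]_w (expR (z * enorm y `^ theta) * K * D w)%:E)).
    apply: ge0_le_integral => //.
      by apply/measurable_EFinP; exact: measurable_funM.
    move=> w _; rewrite lee_fin.
    apply: (@le_trans _ _ (expR (z * enorm y `^ theta + z * enorm (X w) `^ theta))).
      by rewrite ler_expR -mulrDr ler_wpM2l// powR_enormD.
    rewrite expRD -mulrA ler_wpM2l ?expR_ge0//; apply: le_trans (hK (X w) _ _ hz hth).
    by rewrite -[leLHS]mul1r ler_wpM2r ?expR_ge0// lerDl.
  under eq_integral do rewrite EFinM.
  rewrite integralZl// EDE -EFinM lee_fin -mulrA ler_wpM2l ?expR_ge0//.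
  by rewrite lerDr.
have [A AE] : {A : R | A = expR (z * enorm y `^ theta)} by eexists.
have [c1 c1E] : {c : R | c = (z * (theta / 2) * enorm y `^ (theta - 2))%R} by eexists.
have [c2 c2E] : {c : R | c = (z ^+ 2 * enorm y `^ (2 * (theta - 1)))%R} by eexists.
have A0 : (0 <= A)%R by rewrite AE expR_ge0.
have c10 : (0 <= c1)%R by rewrite c1E !mulr_ge0 ?powR_ge0.
have c20 : (0 <= c2)%R by rewrite c2E; apply: mulr_ge0; [exact: sqr_ge0|exact: powR_ge0].
have [L LE] : {L : Omega -> R | L = fun w => dot y (X w)} by eexists.
have LwE w : dot y (X w) = L w by rewrite LE.
have iL : Pr.-integrable setT (fun w => (L w)%:E).
  by rewrite LE; exact: (dot_zero_mean y).1.
have L0 : \int[Pr]_w (L w)%:E = 0 by rewrite LE; exact: (dot_zero_mean y).2.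
rewrite -AE.
apply: (@le_trans _ _
    (\int[Pr]_w ((A * (1 + (c1 + c2) * (K * D w)))%:E + (A * c1 * 2 * L w)%:E))).
  have mL : measurable_fun setT L by apply/measurable_EFinP; exact: measurable_int iL.
  have Fle w : (expR (z * enorm (y + X w)%R `^ theta) <=
      A * (1 + (c1 + c2) * (K * D w)) + A * c1 * 2 * L w)%R.
    apply: le_trans (expR_enormD_le (X w) z_ge0 th01 y0) _.
    rewrite -AE -c1E -c2E LwE.
    rewrite [leRHS](_ : _ = A * (1 + (c1 + c2) * (K * D w) + c1 * (2 * L w)))%R; last by ring.
    rewrite ler_wpM2l//.
    have := hK (X w) _ _ hz hth; rewrite -/(D w).
    set q := expR (z * enorm (X w) `^ theta); set n2 := (enorm (X w) ^+ 2)%R => h.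
    have h1 : (n2 <= K * D w)%R.
      by apply: le_trans h; have := e1 w; have := s0 w; rewrite -/q -/n2; nra.
    have h2 : (n2 * q <= K * D w)%R.
      by apply: le_trans h; have := e1 w; rewrite -/q; nra.
    have := lerD (ler_wpM2l c10 h1) (ler_wpM2l c20 h2).
    move: (K * D w)%R (n2 * q)%R (L w) => k m l {}h.
    have -> : (1 + c1 * (2 * l + n2) + c2 * m = 1 + c1 * (2 * l) + (c1 * n2 + c2 * m))%R.
      by ring.
    have -> : (1 + (c1 + c2) * k + c1 * (2 * l) = 1 + c1 * (2 * l) + (c1 * k + c2 * k))%R.
      by ring.
    by rewrite lerD2l.
  apply: ge0_le_integral => //.
  - apply/measurable_EFinP; apply: measurable_funD; last exact: measurable_funM.
    apply: measurable_funM => //; apply: measurable_funD => //.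
    by apply: measurable_funM => //; exact: measurable_funM.
  - by move=> w _; have := Fle w; rewrite -lee_fin EFinD; apply.
have iKD : Pr.-integrable setT (fun w => (K * D w)%:E).
  by under eq_fun do rewrite EFinM; apply: integrableZl.
have i1 : Pr.-integrable setT (fun w => ((c1 + c2) * (K * D w))%:E).
  by under eq_fun do rewrite EFinM; apply: integrableZl.
have i0 : Pr.-integrable setT (fun=> 1%:E) by exact: finite_measure_integrable_cst.
rewrite integralD//; last 2 first.
- under eq_fun do rewrite EFinM EFinD; apply: integrableZl => //.
  exact: integrableD.
- by under eq_fun do rewrite EFinM; apply: integrableZl.
rewrite [X in _ + X](_ : _ = 0) ?adde0; last first.
  by under eq_integral do rewrite EFinM; rewrite integralZl// L0 mule0.
under eq_integral do rewrite EFinM EFinD.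
rewrite integralZl//; last exact: integrableD.
rewrite integralD// integral_cst//.
rewrite [X in 1 * X](_ : _ = 1) ?mule1; last exact: probability_setT.
under eq_integral do rewrite EFinM.
rewrite integralZl//.
under eq_integral do rewrite EFinM.
rewrite integralZl// EDE.
apply: (@le_trans _ _ (A * (1 + (c1 + c2) * (K * ED)))%:E).
  by rewrite [in leRHS]EFinM [in leRHS]EFinD !EFinM.
rewrite lee_fin ler_wpM2l//.
rewrite -addrA lerD2l.
have KED : (0 <= K * ED)%R by rewrite mulr_ge0 ?(ltW K0)// (le_trans _ ED1).
have c1le : (c1 <= z * enorm y `^ (theta - 2))%R.
  by rewrite c1E ler_wpM2r ?powR_ge0// ler_piMr//; lra.
rewrite [leRHS](_ : _ =
  ((z * enorm y `^ (theta - 2) + c2) * (1 + K * ED))%R); last by rewrite c2E; ring.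
apply: ler_pM => //; [exact: addr_ge0| |by rewrite lerDr].
by rewrite lerD2r.
Qed.

End integrated_drift.

Section kernel_drift.
Context {R : realType} {d : nat} {dO : measure_display} {Omega : measurableType dO}.
Variables (Pr : probability Omega R) (X : {RV Pr >-> 'rV[R]_d}).
Variables (g : 'rV[R]_d -> 'rV[R]_d) (P : R.-pker 'rV[R]_d ~> 'rV[R]_d).
Hypothesis PE : forall (x : 'rV[R]_d) (A : set 'rV[R]_d), measurable A ->
  P x A = Pr [set w | A (g x + X w)].
Local Open Scope ereal_scope.

Lemma integral_autoregressive (x : 'rV[R]_d) (f : 'rV[R]_d -> \bar R) :
  (forall y, 0 <= f y) -> measurable_fun setT f ->
  \int[P x]_y f y = \int[Pr]_w f (g x + X w)%R.
Proof.
move=> f0 mf.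
have mphi : measurable_fun setT (fun w => g x + X w)%R.
  exact: (measurableT_comp (measurable_shiftl_rV (g x))).
transitivity (\int[pushforward Pr (fun w => g x + X w)%R]_y f y).
  by apply: eq_measure_integral => A mA _; exact: PE.
by rewrite ge0_integral_pushforward.
Qed.

Variables (z0 gamma0 rho : R).
Hypotheses (z00 : (0 < z0)%R) (gamma00 : (0 < gamma0 <= 1)%R).
Hypotheses (X0 : zero_mean X) (Xmom : subexponential_moment z0 gamma0 X).
Hypothesis g_drift : drift_assumption g rho.
Hypothesis g_le : forall x, (enorm (g x) <= enorm x)%R.

Local Notation V := (exp_weight (@enorm R d)).

(** If [|g x| < |x| / 2] the weight drops by the factor
    [exp (- a |x|^theta)], which beats the constant of the crude bound for large
    [x]; otherwise [drift_numeric] applies. *)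
Lemma autoregressive_drift (theta : R) :
  (0 < theta)%R -> (theta <= gamma0)%R -> (theta <= 2 - rho)%R ->
  (theta < rho)%R -> (rho < 2)%R ->
  exists z kappa R1 b : R,
  [/\ (0 < z < z0)%R, (0 < kappa <= 2^-1)%R, (1 <= R1)%R /\ (0 <= b)%R,
    forall x, (R1 <= enorm x)%R -> \int[P x]_y (V z theta y)%:E <=
      ((1 - kappa * enorm x `^ (theta - rho)) * V z theta x)%:E &
    forall x, (enorm x <= R1)%R -> \int[P x]_y (V z theta y)%:E <= b%:E].
Proof.
move=> th0 thg th2 thrho rho2.
have [K K1 hK] := integrated_drift z00 gamma00 X0 Xmom.
have [_ [r0 [R0 [r00 R00 g_dec]]]] := g_drift.
have K0 : (0 < K)%R by exact: lt_le_trans K1.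
have th1 : (theta <= 1)%R by apply: le_trans thg _; case/andP: gamma00.
have tr0 : (0 < theta * r0)%R by rewrite mulr_gt0.
(* [z0 / 2] keeps half of the exponential moment for the factor [1 + |e|^2]; the
   other two bounds are the requirements of [drift_numeric] on [z] *)
have [z zE] : {z : R | z =
    Num.min (z0 / 2)%R (Num.min (theta * r0 / (16 * K))%R (theta * r0)^-1%R)}.
  by eexists.
have z_gt0 : (0 < z)%R by rewrite zE !lt_min !divr_gt0 ?mulr_gt0// invr_gt0.
have zz0 : (z <= z0 / 2)%R by rewrite zE ge_min lexx.
have zK : (4 * K * z <= theta * r0 / 4)%R.
  have : (z <= theta * r0 / (16 * K))%R by rewrite zE !ge_min lexx orbT.
  rewrite ler_pdivlMr ?mulr_gt0// => h.
  rewrite [leLHS](_ : _ = z * (16 * K) / 4)%R; last by field.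
  by rewrite ler_pM2r ?invr_gt0.
have zr : (z * theta * r0 <= 1)%R.
  have : (z <= (theta * r0)^-1)%R by rewrite zE !ge_min lexx !orbT.
  by rewrite -[X in (_ <= X)%R -> _]mul1r ler_pdivlMr// mulrA.
have zr0 : (0 < z * theta * r0)%R by rewrite !mulr_gt0.
have rho2' : (0 < 2 - rho)%R by lra.
have [S1 S11 hS1] := powR_unbounded (16 * K / (theta * r0))%R rho2'.
have p2 : (2 `^ (- theta) < 1)%R.
  have -> : (2 `^ (- theta) = 2^-1 `^ theta :> R)%R.
    by rewrite -[(2^-1)%R]powR_inv1// -powRrM mulN1r.
  rewrite [ltRHS](_ : _ = 1 `^ theta)%R; last by rewrite powR1.
  by apply: gt0_ltr_powR; rewrite ?nnegrE// invf_lt1// ltr1n.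
have [a aE] : {a : R | a = (z * (1 - 2 `^ (- theta)))%R} by eexists.
have a0 : (0 < a)%R by rewrite aE mulr_gt0// subr_gt0.
have [S2 S21 hS2] := powR_unbounded (2 * K / a)%R th0.
pose R1 := Num.max R0 (Num.max S1 S2).
have R11 : (1 <= R1)%R by rewrite !le_max S11 !orbT.
have hz : (0 <= z <= z0 / 2)%R by rewrite (ltW z_gt0).
have hth : (0 <= theta <= gamma0)%R by rewrite (ltW th0).
have PV x : \int[P x]_y (V z theta y)%:E =
    \int[Pr]_w (expR (z * enorm (g x + X w)%R `^ theta))%:E.
  apply: (@integral_autoregressive x (fun y => (V z theta y)%:E)).
    by move=> y; rewrite lee_fin; exact: expR_ge0.
  apply/measurable_EFinP; exact: measurable_exp_weight measurable_enorm.
exists z, (z * theta * r0 / 4)%R, R1, (expR (z * R1 `^ theta) * K)%R.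
split.
- by rewrite z_gt0/=; lra.
- by apply/andP; split; lra.
- by split => //; rewrite mulr_ge0 ?expR_ge0// ltW.
- move=> x; rewrite !ge_max => /and3P[xR0 xS1 xS2].
  rewrite PV; have [crude fine] := hK (g x) _ _ hz hth.
  have s1 : (1 <= enorm x)%R by exact: le_trans xS1.
  have s0 : (0 < enorm x)%R by exact: lt_le_trans s1.
  have [small|large] := ltP (enorm (g x)) (enorm x / 2)%R.
    apply: le_trans crude _; rewrite lee_fin mulrC.
    have h1 : (enorm x `^ (theta - rho) <= 1)%R.
      by rewrite -[leRHS](powRr0 (enorm x)); apply: ler_powR => //; rewrite subr_le0 ltW.
    have h0 := powR_ge0 (enorm x) (theta - rho).
    apply: (@le_trans _ _ (2^-1 * V z theta x)%R); last first.
      by rewrite ler_wpM2r ?expR_ge0//; nra.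
    have gx : (enorm (g x) `^ theta <= 2 `^ (- theta) * enorm x `^ theta)%R.
      have -> : (2 `^ (- theta) = 2^-1 `^ theta :> R)%R.
        by rewrite -[(2^-1)%R]powR_inv1// -powRrM mulN1r.
      rewrite -powRM// ?(ltW s0)//.
      apply: ge0_ler_powR; rewrite ?nnegrE ?mulr_ge0 ?enorm_ge0 ?(ltW th0)//.
      by rewrite mulrC ltW.
    apply: (@le_trans _ _ (K * expR (z * (2 `^ (- theta) * enorm x `^ theta))))%R.
      by rewrite ler_pM2l// ler_expR ler_pM2l.
    have -> : V z theta x =
        (expR (a * enorm x `^ theta) * expR (z * (2 `^ (- theta) * enorm x `^ theta)))%R.
      by rewrite /exp_weight -expRD; congr expR; rewrite aE; ring.
    rewrite [leRHS]mulrA ler_wpM2r ?expR_ge0//.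
    have := hS2 _ xS2; rewrite ler_pdivrMr// => h.
    by have := expR_ge1Dx (a * enorm x `^ theta)%R; lra.
  apply: le_trans (fine _) _; first by apply: lt_le_trans large; rewrite divr_gt0.
  rewrite lee_fin [leRHS]mulrC; apply: drift_numeric => //.
  - by rewrite th0.
  - exact: g_dec.
  - by lra.
  - exact: hS1.
- move=> x xR; rewrite PV; apply: le_trans (hK (g x) _ _ hz hth).1 _.
  rewrite lee_fin ler_wpM2r ?(ltW K0)// ler_expR ler_wpM2l ?(ltW z_gt0)//.
  apply: ge0_ler_powR; rewrite ?nnegrE ?enorm_ge0 ?(ltW th0)//.
    by rewrite (le_trans _ R11).
  exact: le_trans (g_le x) _.
Qed.

End kernel_drift.

(** * Weighted sums and a renewal inequality *)

Section stretched_exponential_sums.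
Context {R : realType}.

Definition stretched (b alpha : R) (n : nat) : R := expR (b * n%:R `^ alpha).

Lemma stretched_gt0 b alpha n : 0 < stretched b alpha n.
Proof. exact: expR_gt0. Qed.

Lemma stretched_le b alpha m n : 0 <= b -> 0 <= alpha -> (m <= n)%N ->
  stretched b alpha m <= stretched b alpha n.
Proof.
move=> b0 a0 mn; rewrite ler_expR ler_wpM2l//.
by apply: ge0_ler_powR; rewrite ?nnegrE// ler_nat.
Qed.

Lemma stretched_submul b alpha m n : 0 <= b -> 0 <= alpha <= 1 ->
  stretched b alpha (m + n) <= stretched b alpha m * stretched b alpha n.
Proof.
move=> b0 a01; rewrite -expRD ler_expR -mulrDr ler_wpM2l// natrD.
exact: powR_subadd.
Qed.

(** The terms are at most a constant times [1 / ((i + 1)(i + 2))], whose sum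
    telescopes. *)
Lemma stretched_summable a alpha : 0 < a -> 0 < alpha ->
  exists2 K : R, 0 < K & forall n, \sum_(i < n) stretched (- a) alpha i <= K.
Proof.
move=> a0 al0; have [K K0 hK] := powR_le_expR al0 a0 (ler0n R 2).
(* [(i + 1)(i + 2)] is at most [9 i^2] for [i >= 1] and equals [2] for [i = 0] *)
exists (9 * K + 2); first by rewrite addr_gt0// mulr_gt0.
have K90 : 0 < 9 * K + 2 by rewrite addr_gt0// mulr_gt0.
move=> n; suff : \sum_(i < n) stretched (- a) alpha i <= (9 * K + 2) * (1 - n.+1%:R^-1).
  by move=> /le_trans; apply; rewrite ler_piMr ?(ltW K90)// gerBl invr_ge0.
elim: n => [|n IH]; first by rewrite big_ord0 invr1 subrr mulr0.
rewrite big_ord_recr/=; apply: le_trans (lerD IH _)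
  (_ : _ + (9 * K + 2) * (n.+1%:R^-1 - n.+2%:R^-1) <= _); last first.
  by rewrite le_eqVlt; apply/orP; left; apply/eqP; ring.
have -> : n.+1%:R^-1 - n.+2%:R^-1 = ((n%:R + 1) * (n%:R + 2))^-1 :> R.
  have n0 : 0 <= n%:R :> R by [].
  have -> : n.+2%:R = n%:R + 2 :> R by rewrite -addn2 natrD.
  rewrite -natr1; field.
  by apply/andP; split; rewrite gt_eqF//; lra.
have n0 : 0 <= n%:R :> R by [].
rewrite ler_pdivlMr; last by rewrite mulr_gt0//; lra.
rewrite /stretched mulNr expRN mulrC ler_pdivrMr ?expR_gt0//.
have e1 : 1 <= expR (a * n%:R `^ alpha).
  by rewrite -[leLHS]expR0 ler_expR mulr_ge0 ?powR_ge0// ltW.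
have := hK n%:R n0; rewrite powR_mulrn//.
case: n n0 e1 {IH} => [|n] _.
  move: (expR _) => q; rewrite mulr0n; nra.
rewrite -natr1; have : 0 <= n%:R :> R by [].
move: (n%:R) (expR _) => m q; nra.
Qed.

(** The increment [(k + N)^alpha - k^alpha] is at most [N k^(alpha - 1)], which tends
    to zero. *)
Lemma stretched_slow b alpha (N : nat) (eps : R) : 0 < b -> 0 < alpha < 1 -> 0 < eps ->
  exists k0, forall k, (k0 <= k)%N ->
    stretched b alpha (k + N) - stretched b alpha k <= eps * stretched b alpha (k + N).
Proof.
move=> b0 /andP[al0 al1] e0.
have al10 : 0 < 1 - alpha by rewrite subr_gt0.
have [S S1 hS] := powR_unbounded (b * N%:R / eps) al10.
exists (Num.bound S) => k kS.
have Sk : S <= k%:R.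
  apply: (@le_trans _ _ (Num.bound S)%:R); last by rewrite ler_nat.
  by apply/ltW/archi_boundP; apply: le_trans S1.
have k0 : 0 < k%:R :> R by apply: lt_le_trans Sk; apply: lt_le_trans S1.
rewrite lerBlDr -lerBlDl -[X in X - _]mul1r -mulrBl.
have -> : stretched b alpha k =
    expR (- (b * ((k + N)%:R `^ alpha - k%:R `^ alpha))) * stretched b alpha (k + N).
  by rewrite -expRD; congr expR; ring.
rewrite ler_pM2r ?stretched_gt0//.
apply: le_trans (expR_ge1Dx _); rewrite lerD2l lerN2.
have : (k + N)%:R `^ alpha - k%:R `^ alpha <= k%:R `^ (alpha - 1) * N%:R.
  apply: le_trans (ler_norm _) _.
  apply: le_trans (@powR_dist_le _ (k + N)%:R k%:R alpha _ _ _) _ => //.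
    by rewrite (ltW al0) ltW.
  by rewrite natrD addrAC subrr add0r ger0_norm.
move=> /(ler_wpM2l (ltW b0)) /le_trans; apply.
have -> : k%:R `^ (alpha - 1) = (k%:R `^ (1 - alpha))^-1 :> R.
  by rewrite -powRN opprB.
have u0 : 0 < k%:R `^ (1 - alpha) :> R by exact: powR_gt0.
move: hS => /(_ _ Sk); move: u0; set u := _ `^ _ => u0.
rewrite ler_pdivrMr// => h.
rewrite [leLHS](_ : _ = b * N%:R / u); last by ring.
by rewrite ler_pdivrMr// mulrC [leRHS]mulrC [X in X <= _]mulrC.
Qed.

Lemma stretched_product_summable b s alpha : 0 < b -> b < s -> 0 < alpha < 1 ->
  exists2 T, 0 < T & forall n,
    \sum_(i < n) stretched b alpha i.+1 * stretched (- s) alpha i <= T.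
Proof.
move=> b0 bs /andP[al0 al1].
have sb0 : 0 < s - b by rewrite subr_gt0.
have [K K0 hK] := stretched_summable sb0 al0.
exists (stretched b alpha 1 * K) => [|n]; first by rewrite mulr_gt0 ?stretched_gt0.
apply: (@le_trans _ _
    (stretched b alpha 1 * \sum_(i < n) stretched (- (s - b)) alpha i)).
  rewrite mulr_sumr; apply: ler_sum => i _.
  have -> : stretched (- (s - b)) alpha i = stretched b alpha i * stretched (- s) alpha i.
    by rewrite /stretched -expRD; congr expR; ring.
  rewrite mulrA; apply: ler_wpM2r; first exact: expR_ge0.
  by rewrite -add1n; apply: stretched_submul; rewrite ?(ltW b0) ?(ltW al0) ?(ltW al1).
by rewrite ler_pM2l ?stretched_gt0.
Qed.

End stretched_exponential_sums.

Section renewal.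
Context {R : realType}.
Variables (a c r t : nat -> R) (p K1 K2 T : R) (N : nat).
Hypotheses (a0 : forall k, 0 <= a k <= 1) (c0 : forall k, 0 <= c k).
Hypotheses (p0 : 0 < p) (K10 : 0 <= K1) (K20 : 0 < K2) (T0 : 0 < T).
Hypotheses (r0 : forall k, 0 < r k) (t0 : forall k, 0 <= t k).
Hypothesis r_homo : {homo r : m n / (m <= n)%N >-> m <= n}.
Hypothesis r_submul : forall m n, r (m + n)%N <= r m * r n.
Hypothesis r_slow : forall eps, 0 < eps -> exists k0, forall k, (k0 <= k)%N ->
  r (k + N)%N - r k <= eps * r (k + N)%N.
Hypothesis rt_summable : forall n, \sum_(i < n) r i.+1 * t i <= T.
Hypothesis visits : forall k, p * c k <= a k - a (k + N)%N.
Hypothesis renewal_bound : forall k,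
  a k <= K1 * t k + K2 * \sum_(j < k) t (k - j.+1)%N * c j.

(** Discrete form of Fubini: [r (j + i + 1) <= r j * r (i + 1)] separates the visit
    at time [j] from the excursion of length [i] that follows it. *)
Let convolution n :
  \sum_(k < n) r k * \sum_(j < k) t (k - j.+1)%N * c j <=
  \sum_(j < n) r j * c j * \sum_(i < n - j.+1) r i.+1 * t i.
Proof.
elim: n => [|n IH]; first by rewrite !big_ord0.
rewrite !big_ord_recr/= subnn big_ord0 mulr0 addr0.
apply: le_trans (lerD IH (lexx _)) _.
rewrite mulr_sumr -big_split/=; apply: ler_sum => j _.
rewrite subSS -(subnSK (ltn_ord j)) big_ord_recr/= mulrDr lerD2l.
apply: (@le_trans _ _ ((r j * r (n - j.+1).+1) * (t (n - j.+1)%N * c j))).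
  apply: ler_wpM2r; first by rewrite mulr_ge0.
  by have := r_submul j (n - j); rewrite subnKC ?subnSK// ltnW.
by rewrite le_eqVlt; apply/orP; left; apply/eqP; ring.
Qed.

Let sum_lt_const (k0 m : nat) (C : R) : 0 <= C ->
  \sum_(j < m) (j < k0)%:R * C <= k0%:R * C.
Proof.
move=> C0; rewrite -mulr_suml ler_wpM2r//.
suff : \sum_(j < m) (j < k0)%:R <= (minn m k0)%:R :> R.
  by move=> /le_trans; apply; rewrite ler_nat geq_minr.
elim: m => [|m IH]; first by rewrite big_ord0.
rewrite big_ord_recr/=; apply: le_trans (lerD IH (lexx _)) _.
rewrite -natrD ler_nat; case: ltnP => h.
  by rewrite addn1 (minn_idPl h).
by rewrite addn0 (minn_idPr (leqW h)).
Qed.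

(** With [S n] the sum in question, [renewal_bound] gives
    [S n <= A + K2 T (sum of r j * c j)], and [visits] together with summation by
    parts gives [p (sum of r j * c j) <= C + eps (S n)]; taking
    [eps = p / (2 K2 T)] leaves half of [S n] on the left. *)
Lemma renewal_bounded : exists M, forall n, \sum_(k < n) r k * a k <= M.
Proof.
have hT := rt_summable.
have rt_sum n : \sum_(k < n) r k * t k <= T.
  apply: le_trans (hT n); apply: ler_sum => k _; apply: ler_wpM2r => //.
  exact: r_homo.
pose S n := \sum_(k < n) r k * a k.
have ra0 k : 0 <= r k * a k by rewrite mulr_ge0 ?(ltW (r0 k))//; case/andP: (a0 k).
have S1 n : S n <= K1 * T + K2 * T * \sum_(j < n) r j * c j.
  apply: (@le_trans _ _ (K1 * (\sum_(k < n) r k * t k) +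
      K2 * \sum_(k < n) r k * \sum_(j < k) t (k - j.+1)%N * c j)).
    rewrite !mulr_sumr -big_split/=; apply: ler_sum => k _.
    apply: le_trans (ler_wpM2l (ltW (r0 k)) (renewal_bound k)) _.
    by rewrite le_eqVlt; apply/orP; left; apply/eqP; ring.
  apply: lerD; first by rewrite ler_wpM2l.
  rewrite -mulrA ler_pM2l//; apply: le_trans (convolution n) _.
  rewrite mulr_sumr; apply: ler_sum => j _.
  by rewrite [leRHS]mulrC ler_wpM2l ?mulr_ge0 ?(ltW (r0 j)).
pose eps := p / (2 * (K2 * T)).
have eps0 : 0 < eps by rewrite divr_gt0// !mulr_gt0.
have [k0 hk0] := r_slow eps0.
pose C := \sum_(k < N) r k + k0%:R * r (k0 + N)%N.
have S2 m : p * \sum_(j < m + N) r j * c j <= C + eps * S (m + N)%N.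
  have split_S : S (m + N)%N =
      \sum_(k < N) r k * a k + \sum_(j < m) r (j + N)%N * a (j + N)%N.
    rewrite /S addnC big_split_ord/=; congr (_ + _).
    by apply: eq_bigr => j _; rewrite addnC.
  apply: (@le_trans _ _ (S (m + N)%N - \sum_(j < m) r j * a (j + N)%N)).
    rewrite mulr_sumr /S big_split_ord/= [in leRHS]big_split_ord/= addrAC -sumrB.
    apply: lerD; apply: ler_sum => j _.
      rewrite mulrCA -mulrBr ler_pM2l//.
    rewrite mulrCA ler_pM2l//; apply: le_trans (visits _) _.
    by rewrite gerBl; case/andP: (a0 (m + j + N)).
  have -> : S (m + N)%N - \sum_(j < m) r j * a (j + N)%N = \sum_(k < N) r k * a k
      + \sum_(j < m) (r (j + N)%N - r j) * a (j + N)%N.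
    rewrite split_S -addrA -sumrB; congr (_ + _).
    by apply: eq_bigr => j _; rewrite mulrBl.
  rewrite /C -addrA; apply: lerD.
    apply: ler_sum => k _; rewrite ler_piMr ?(ltW (r0 k))//.
    by case/andP: (a0 k).
  apply: (@le_trans _ _ (\sum_(j < m) ((j < k0)%:R * r (k0 + N)%N +
      eps * (r (j + N)%N * a (j + N)%N)))).
    apply: ler_sum => j _; have /andP[aj0 aj1] := a0 (j + N)%N.
    case: ltnP => hj.
      rewrite mul1r; apply: (@le_trans _ _ (r (k0 + N)%N)).
        apply: (@le_trans _ _ (r (j + N)%N)).
          apply: (@le_trans _ _ (r (j + N)%N * a (j + N)%N)).
            by rewrite ler_wpM2r// gerBl ltW.
          by rewrite ler_piMr// ltW.
        by apply: r_homo; rewrite leq_add2r ltnW.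
      by rewrite lerDl mulr_ge0// ltW.
    by rewrite mul0r add0r mulrA ler_wpM2r// hk0.
  rewrite big_split/=; apply: lerD; first exact/sum_lt_const/ltW.
  rewrite -mulr_sumr ler_pM2l// split_S lerDr.
  by apply: sumr_ge0 => k _; exact: ra0.
exists (2 * (K1 * T + K2 * T / p * C)) => n.
apply: (@le_trans _ _ (S (n + N)%N)).
  rewrite /S big_split_ord/= lerDl; apply: sumr_ge0 => k _; exact: ra0.
have := S1 (n + N)%N; have := S2 n; move: (S _) (\sum_(j < _) _) => Sn Wn h2 h1.
have h3 : K2 * T * Wn <= K2 * T / p * C + Sn / 2.
  rewrite [leLHS](_ : _ = K2 * T / p * (p * Wn)); last by field; rewrite gt_eqF.
  apply: le_trans (ler_wpM2l _ h2) _; first by rewrite divr_ge0 ?mulr_ge0// ltW.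
  rewrite le_eqVlt; apply/orP; left; apply/eqP; rewrite /eps; field.
  by rewrite !gt_eqF.
by lra.
Qed.
End renewal.

(** * The chain killed when it hits a set *)

Section killed_chain.
Local Open Scope ereal_scope.
Context {R : realType} {dT : measure_display} {T : measurableType dT}.
Variable P : R.-pker T ~> T.

Lemma ge0_integral_mrestr d (Y : measurableType d) (mu : {measure set Y -> \bar R})
    (D : set Y) (mD : measurable D) (f : Y -> \bar R) :
  (forall x, 0 <= f x) -> measurable_fun setT f ->
  \int[mrestr mu mD]_x f x = \int[mu]_(x in D) f x.
Proof.
move=> f0 mf.
have mDC : measurable (~` D) by exact: measurableC.
rewrite (@ge0_negligible_integral _ _ _ _ setT (~` D) _ mDC measurableT mf)//.
  rewrite setTD setCK; apply: eq_measure_integral => A mA AD.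
  by rewrite /= /mrestr setIidl.
by rewrite /= /mrestr setICl measure0.
Qed.

Context {dO : measure_display} {Omega : measurableType dO}.
Variables (Q : probability Omega R) (lam : probability T R).
Variable Phi : nat -> {RV Q >-> T}.
Hypothesis Phi_chain : markov_chain P lam Phi.
Variable B : set T.
Hypothesis mB : measurable B.

Let mPhi k : measurable_fun setT (Phi k). Proof. by []. Qed.

(** Time [0] is exempt because hitting times are at least [1]. *)
Let avoid (k : nat) : set T := if k == 0%N then setT else ~` B.

Let m_avoid k : measurable (avoid k).
Proof. by rewrite /avoid; case: ifP => // _; exact: measurableC. Qed.

Definition survival (k : nat) : set Omega :=
  \bigcap_(j in `I_k.+1) (Phi j @^-1` avoid j).

Lemma measurable_survival k : measurable (survival k).
Proof.
apply: bigcap_measurable => [|j _]; first by exists 0%N.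
by rewrite -[X in measurable X]setTI; exact: measurable_funP.
Qed.

Lemma survival0 : survival 0 = setT.
Proof. by apply/seteqP; split => // w _ [|j]. Qed.

Lemma survivalP k w : survival k w <-> k%:R%:E < hitting_time Phi B w.
Proof.
split=> [sw|hk j /= jk].
  apply: (@lt_le_trans _ _ k.+1%:R%:E); first by rewrite lte_fin ltr_nat.
  apply: le_ereal_inf_tmp => _ [n [n0 Bn] <-].
  rewrite lee_fin ler_nat ltnNge; apply/negP => nk.
  by have := sw n nk; rewrite /avoid/= gtn_eqF//; apply.
rewrite /avoid; case: eqP => // /eqP; rewrite -lt0n => j0 Bj.
have : hitting_time Phi B w <= j%:R%:E by apply: ereal_inf_lbound; exists j.
by move=> /(lt_le_trans hk); rewrite lte_fin ltr_nat ltnNge -ltnS jk.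
Qed.

Definition killed_law (k : nat) : {measure set T -> \bar R} :=
  measure_function_pushforward__canonical__measure_function_Measure
    (mrestr Q (measurable_survival k)) (mPhi k).

Lemma integral_killed_law k (h : T -> \bar R) : (forall x, 0 <= h x) ->
  measurable_fun setT h ->
  \int[killed_law k]_x h x = \int[Q]_(w in survival k) h (Phi k w).
Proof.
move=> h0 mh; rewrite ge0_integral_pushforward//.
rewrite (ge0_integral_mrestr _ _ (fun w => h0 (Phi k w)))//.
exact: (measurableT_comp mh (mPhi k)).
Qed.

Lemma killed_lawE k A : killed_law k A = Q (Phi k @^-1` A `&` survival k).
Proof. by []. Qed.

Lemma killed_law0 A : measurable A -> killed_law 0 A = lam A.
Proof. by move=> mA; rewrite killed_lawE survival0 setIT -Phi_chain.1. Qed.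

Lemma killed_law_le1 k : killed_law k setT <= 1.
Proof.
rewrite killed_lawE preimage_setT setTI; apply: probability_le1.
exact: measurable_survival.
Qed.

Lemma killed_law_hit k : killed_law k.+1 B = 0.
Proof.
rewrite killed_lawE (_ : _ `&` _ = set0) ?measure0//.
apply/seteqP; split => // w [Bw] /(_ k.+1 (leqnn _)).
by rewrite /avoid/=; apply.
Qed.

(** Equality would hold with [h] cut off on [B]; the inequality suffices because
    these integrals only need upper bounds. *)
Lemma killed_lawS k (h : T -> \bar R) : (forall x, 0 <= h x) ->
  measurable_fun setT h ->
  \int[killed_law k.+1]_x h x <= \int[killed_law k]_x \int[P x]_y h y.
Proof.
move=> h0 mh.
have mS := measurable_survival.
pose n : {measure set T -> \bar R} :=
  measure_function_pushforward__canonical__measure_function_Measure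
    (mrestr Q (mS k)) (mPhi k.+1).
rewrite -(@ge0_integral_mkernel _ _ _ _ _ (killed_law k) P n)//; last first.
  move=> A mA; rewrite /mkernel integral_killed_law//; last exact: measurable_kernel.
  have := Phi_chain.2 k avoid A m_avoid mA => /= <-.
  by rewrite setIC.
have mhP := measurableT_comp mh (mPhi k.+1).
rewrite integral_killed_law// ge0_integral_pushforward//.
rewrite (ge0_integral_mrestr _ _ (fun w => h0 (Phi k.+1 w)))//.
apply: ge0_subset_integral => //.
- exact: measurable_funTS.
- move=> w sw j jk; apply: sw; exact: leqW.
Qed.

(** This turns regularity into a statement about the sequence of laws alone. *)
Lemma integral_until_hitting (u : nat -> T -> \bar R) :
  (forall k x, 0 <= u k x) -> (forall k, measurable_fun setT (u k)) ->
  \int[Q]_w (\sum_(k <oo | k%:R%:E < hitting_time Phi B w) u k (Phi k w)) =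
  \sum_(k <oo) \int[killed_law k]_x u k x.
Proof.
move=> u0 mu.
under eq_integral => w _.
  rewrite eseries_mkcond.
  under eq_eseriesr => k _.
    rewrite (_ : (if _ then _ else _) =
        ((fun v => u k (Phi k v)) \_ (survival k)) w); last first.
      rewrite patchE; case: ifPn => [/survivalP sk|sk]; first by rewrite mem_set.
      by rewrite memNset// => /survivalP; apply/negP.
    over.
  over.
rewrite integral_nneseries//; last 2 first.
- move=> k; apply/(measurable_restrictT _ (measurable_survival k)).
  by apply: measurable_funTS; exact: (measurableT_comp (mu k) (mPhi k)).
- by move=> k w _; rewrite erestrict_ge0.
apply: eq_eseriesr => k _.
by rewrite integral_killed_law// [RHS]integral_mkcond.
Qed.

End killed_chain.

(** * Avoiding a set for a long time *)

Section taboo_probabilities.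
Local Open Scope ereal_scope.
Context {R : realType} {dT : measure_display} {T : measurableType dT}.
Variables (P : R.-pker T ~> T) (C : set T) (V : T -> R).
Hypotheses (mC : measurable C) (V1 : forall x, (1 <= V x)%R).
Hypothesis mV : measurable_fun setT V.

(** The probability that the chain started at [x] avoids [C] at the times
    [0, ..., n - 1]. *)
Fixpoint taboo (n : nat) (x : T) : \bar R :=
  if n is n'.+1 then (\1_(~` C) x)%:E * \int[P x]_y taboo n' y else 1.

Lemma taboo_ge0 n x : 0 <= taboo n x.
Proof.
elim: n x => [|n IH] x //=; rewrite mule_ge0// ?lee_fin//.
by apply: integral_ge0 => y _; exact: IH.
Qed.

Lemma measurable_taboo n : measurable_fun setT (taboo n).
Proof.
elim: n => [|n IH] /=; first exact: measurable_cst.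
apply: emeasurable_funM.
  by apply/measurable_EFinP; apply: measurable_indic; exact: measurableC.
apply: measurable_fun_integral_kernel => //; last exact: taboo_ge0.
exact: measurable_kernel.
Qed.

Lemma taboo_in n x : C x -> taboo n.+1 x = 0.
Proof. by move=> Cx /=; rewrite indicE memNset ?mul0e//; apply. Qed.

Lemma taboo_out n x : ~ C x -> taboo n.+1 x = \int[P x]_y taboo n y.
Proof. by move=> Cx /=; rewrite indicE mem_set// mul1e. Qed.

Lemma taboo_le1 n x : taboo n x <= 1.
Proof.
elim: n x => [|n IH] x //.
have [Cx|Cx] := pselect (C x); first by rewrite taboo_in.
rewrite taboo_out//; apply: (@le_trans _ _ (\int[P x]_y 1)).
  apply: ge0_le_integral => //.
  - by move=> y _; exact: taboo_ge0.
  - exact: measurable_taboo.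
by rewrite integral_cst// mul1e; exact: sprob_kernel_le1.
Qed.

Let V0 x : (0 <= V x)%R. Proof. exact: le_trans (V1 x). Qed.

(** Points where the drift fails to contract by [1 - k] are allowed, provided
    [D * V] exceeds one there: at such points the bound is trivial because [taboo]
    is a probability. *)
Lemma taboo_le_geometric (k D : R) n x : (0 <= k <= 1)%R -> (0 <= D)%R ->
  (forall y, ~ C y -> \int[P y]_u (V u)%:E <= ((1 - k) * V y)%:E \/ (1 <= D * V y)%R) ->
  taboo n x <= (((1 - k) ^+ n + D) * V x)%:E.
Proof.
move=> /andP[k0 k1] D0 hV.
have k1' : (0 <= 1 - k)%R by rewrite subr_ge0.
have w0 i : (0 <= (1 - k) ^+ i + D)%R by rewrite addr_ge0// exprn_ge0.
elim: n x => [|n IH] x.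
  by rewrite expr0 lee_fin mulr_ege1// lerDl.
have [Cx|Cx] := pselect (C x).
  by rewrite taboo_in// lee_fin mulr_ge0.
have [drift|big] := hV x Cx; last first.
  apply: le_trans (taboo_le1 _ _) _; rewrite lee_fin; apply: le_trans big _.
  by rewrite ler_wpM2r// lerDr exprn_ge0.
rewrite taboo_out//.
apply: (@le_trans _ _ (\int[P x]_y (((1 - k) ^+ n + D)%:E * (V y)%:E))).
  apply: ge0_le_integral => //.
  - by move=> y _; exact: taboo_ge0.
  - exact: measurable_taboo.
  - by apply: measurable_funeM; exact/measurable_EFinP.
rewrite ge0_integralZl//; last 3 first.
- exact/measurable_EFinP.
- by move=> y _; rewrite lee_fin.
- by rewrite lee_fin.
apply: (@le_trans _ _ (((1 - k) ^+ n + D)%:E * ((1 - k) * V x)%:E)).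
  by rewrite lee_wpmul2l// lee_fin.
rewrite -EFinM lee_fin mulrA ler_wpM2r// mulrDl -exprSr lerD2l.
by rewrite ler_piMr// gerBl.
Qed.

#[local] Arguments taboo : simpl never.

Section last_exit.
Variable law : nat -> {measure set T -> \bar R}.
Hypothesis lawS : forall k (h : T -> \bar R), (forall x, 0 <= h x) ->
  measurable_fun setT h -> \int[law k.+1]_x h x <= \int[law k]_x \int[P x]_y h y.
Variables (t : nat -> R) (b : R).
Hypotheses (t0 : forall n, (0 <= t n)%R) (b0 : (0 <= b)%R).
Hypothesis taboo_t : forall n x, taboo n x <= (t n * V x)%:E.
Hypothesis PVC : forall x, C x -> \int[P x]_y (V y)%:E <= b%:E.

(** The chain started in [C] has zero probability of avoiding [C], but after one
    step it may start a new excursion; this is the second term. *)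
Lemma integral_taboo_step n x :
  \int[P x]_y taboo n y <= taboo n.+1 x + (b * t n)%:E * (\1_C x)%:E.
Proof.
have [Cx|Cx] := pselect (C x); last first.
  by rewrite taboo_out// indicE memNset// mule0 adde0.
rewrite taboo_in// add0e indicE mem_set// mule1.
apply: (@le_trans _ _ (\int[P x]_y ((t n)%:E * (V y)%:E))).
  apply: ge0_le_integral => //.
  - by move=> y _; exact: taboo_ge0.
  - exact: measurable_taboo.
  - by apply: measurable_funeM; exact/measurable_EFinP.
rewrite ge0_integralZl//; last 3 first.
- exact/measurable_EFinP.
- by move=> y _; rewrite lee_fin.
- by rewrite lee_fin.
by rewrite mulrC EFinM lee_wpmul2l ?lee_fin//; exact: PVC.
Qed.

(** The [j]-th term collects the paths whose last visit to [C] before time [k]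
    takes place at time [j]. *)
Lemma last_exit_decomposition k i :
  \int[law k]_x taboo i x <= \int[law 0]_x taboo (k + i) x +
    \sum_(j < k) (b * t (k - j.+1 + i)%N)%:E * law j C.
Proof.
elim: k i => [|k IH] i; first by rewrite big_ord0 adde0.
apply: le_trans (lawS _ (taboo_ge0 i) (measurable_taboo i)) _.
apply: (@le_trans _ _ (\int[law k]_x (taboo i.+1 x + (b * t i)%:E * (\1_C x)%:E))).
  apply: ge0_le_integral => //.
  - by move=> x _; apply: integral_ge0 => y _; exact: taboo_ge0.
  - apply: measurable_fun_integral_kernel => //; last exact: measurable_taboo.
    + exact: measurable_kernel.
    + exact: taboo_ge0.
  - apply: emeasurable_funD; first exact: measurable_taboo.
    by apply: measurable_funeM; apply/measurable_EFinP; exact: measurable_indic.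
  - by move=> x _; exact: integral_taboo_step.
rewrite ge0_integralD//; last 4 first.
- by move=> x _; exact: taboo_ge0.
- exact: measurable_taboo.
- by move=> x _; rewrite mule_ge0// lee_fin mulr_ge0.
- by apply: measurable_funeM; apply/measurable_EFinP; exact: measurable_indic.
rewrite ge0_integralZl//; last 2 first.
- by apply/measurable_EFinP; exact: measurable_indic.
- by rewrite lee_fin mulr_ge0.
rewrite integral_indic// setIT big_ord_recr/= subnn add0n addeA.
apply: leeD => //; apply: le_trans (IH i.+1) _.
rewrite addnS leeD2l//; rewrite le_eqVlt; apply/orP; left; apply/eqP.
apply: eq_bigr => j _; do 4 congr (_ _).
by rewrite subSS -(subnSK (ltn_ord j)) addnS.
Qed.

End last_exit.
End taboo_probabilities.

(** * Visits and drift along the killed chain *)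

Section killed_laws.
Local Open Scope ereal_scope.
Context {R : realType} {dT : measure_display} {T : measurableType dT}.
Variables (P : R.-pker T ~> T) (law : nat -> {measure set T -> \bar R}) (B : set T).
Hypothesis mB : measurable B.
Hypothesis lawS : forall k (h : T -> \bar R), (forall x, 0 <= h x) ->
  measurable_fun setT h -> \int[law k.+1]_x h x <= \int[law k]_x \int[P x]_y h y.
Hypothesis law_hit : forall k, law k.+1 B = 0.

Lemma killed_law_kiter A k i j : measurable A ->
  \int[law (k + j)%N]_x kiter P i x A <= \int[law k]_x kiter P (j + i)%N x A.
Proof.
move=> mA; elim: j i => [|j IH] i; first by rewrite addn0.
rewrite addnS; apply: le_trans (lawS _ _ _) _ => //; first exact: measurable_kiter.
by rewrite addSn -addnS; exact: (IH i.+1).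
Qed.

(** A visit to [C] at time [k] is followed by a hit of [B] at time [k + N] with
    probability at least [p], and that hit removes mass from the killed chain. *)
Lemma killed_law_visits (C : set T) (N : nat) (p : R) k : measurable C ->
  (0 < N)%N -> (0 < p)%R -> (forall x, C x -> p%:E <= kiter P N x B) ->
  p%:E * law k C + law (k + N)%N setT <= law k setT.
Proof.
move=> mC N0 p0 PN.
have mBC : measurable (~` B) by exact: measurableC.
have kC : law (k + N)%N setT <= \int[law k]_x kiter P N x (~` B).
  have := killed_law_kiter k 0 N mBC; rewrite addn0.
  apply: le_trans; rewrite (eq_integral (fun x => (\1_(~` B) x)%:E))//.
  rewrite integral_indic// setIT.
  have hB : law (k + N)%N B = 0 by rewrite -(prednK N0) addnS.
  have : law (k + N)%N setT = law (k + N)%N (~` B) + law (k + N)%N B.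
    by rewrite -measureU// ?setICl// setvU.
  by rewrite hB adde0 => ->.
have mkB i : measurable_fun setT (fun x => kiter P i x B) by exact: measurable_kiter.
apply: le_trans (leeD (lexx _) kC) _.
rewrite -[X in _ <= X]mul1e -[in leRHS]integral_cst//.
have mC1 : measurable_fun setT (fun x => (\1_C x : R)%:E).
  by apply/measurable_EFinP; exact: measurable_indic.
have -> : p%:E * law k C = \int[law k]_x (p%:E * (\1_C x)%:E).
  by rewrite ge0_integralZl ?integral_indic ?setIT ?lee_fin ?(ltW p0).
rewrite -ge0_integralD//; last 3 first.
- by move=> x _; rewrite mule_ge0// lee_fin// ltW.
- exact: measurable_funeM.
- exact: measurable_kiter.
apply: ge0_le_integral => //.
- by move=> x _; rewrite adde_ge0// mule_ge0// lee_fin// ltW.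
- apply: emeasurable_funD; last exact: measurable_kiter.
  exact: measurable_funeM.
move=> x _.
have h : kiter P N x B + kiter P N x (~` B) <= 1.
  apply: le_trans (sprob_kernel_le1 (kiter P N) x).
  by rewrite -measureU// ?setICr// setUv.
apply: le_trans (leeD _ (lexx _)) h.
have [Cx|Cx] := pselect (C x); first by rewrite indicE mem_set// mule1; exact: PN.
by rewrite indicE memNset// mule0.
Qed.

Lemma killed_law_drift (V F : T -> R) (b : R) n : (0 <= b)%R ->
  (forall x, (0 <= V x)%R) -> (forall x, (0 <= F x)%R) ->
  measurable_fun setT V -> measurable_fun setT F ->
  (forall x, \int[P x]_y (V y)%:E + (F x)%:E <= (V x + b)%:E) ->
  \int[law n]_x (V x)%:E + \sum_(k < n) \int[law k]_x (F x)%:E <=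
  \int[law 0]_x (V x)%:E + \sum_(k < n) b%:E * law k setT.
Proof.
move=> b0 V0 F0 mV mF PVF.
have mVE : measurable_fun setT (EFin \o V) by exact/measurable_EFinP.
have mFE : measurable_fun setT (EFin \o F) by exact/measurable_EFinP.
elim: n => [|n IH]; first by rewrite !big_ord0 !adde0.
rewrite !big_ord_recr/= [in leRHS]addeA.
apply: (@le_trans _ _ (\int[law n]_x (V x)%:E + b%:E * law n setT +
    \sum_(k < n) \int[law k]_x (F x)%:E)); last first.
  by rewrite addeAC; apply: leeD.
rewrite addeCA [leRHS]addeC; apply: leeD => //.
have V0E x : 0 <= (V x)%:E by rewrite lee_fin.
apply: (@le_trans _ _ (\int[law n]_x (\int[P x]_y (V y)%:E) + \int[law n]_x (F x)%:E)).
  by apply: leeD => //; exact: lawS.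
have mPV : measurable_fun setT (fun x => \int[P x]_y (V y)%:E).
  by apply: measurable_fun_integral_kernel => //; exact: measurable_kernel.
have PV0 x : 0 <= \int[P x]_y (V y)%:E by apply: integral_ge0 => y _; exact: V0E.
rewrite -ge0_integralD//.
rewrite -integral_cst// -ge0_integralD//.
apply: ge0_le_integral => //.
- by move=> x _; apply: adde_ge0 => //; rewrite lee_fin.
- exact: emeasurable_funD.
- exact: emeasurable_funD.
- by move=> x _; rewrite lee_fin.
Qed.

End killed_laws.

(** * Stretched exponential moments of hitting times *)

Section subgeometric_regularity.
Local Open Scope ereal_scope.
Context {R : realType} {dT : measure_display} {T : measurableType dT}.
Variables (P : R.-pker T ~> T) (e : T -> R).
Variables (z kappa R1 b theta rho : R).
Hypotheses (e0 : forall x, (0 <= e x)%R) (me : measurable_fun setT e).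
Hypotheses (z0 : (0 < z)%R) (kappa0 : (0 < kappa <= 2^-1)%R) (R11 : (1 <= R1)%R).
Hypotheses (b0 : (0 <= b)%R) (th0 : (0 < theta)%R) (thrho : (theta < rho)%R).

Local Notation W a := (exp_weight e a theta).
Let C : set T := [set x | (e x <= R1)%R].

Hypothesis drift_out : forall x, (R1 <= e x)%R -> \int[P x]_y (W z y)%:E <=
  ((1 - kappa * e x `^ (theta - rho)) * W z x)%:E.
Hypothesis drift_in : forall x, (e x <= R1)%R -> \int[P x]_y (W z y)%:E <= b%:E.

Let rho0 : (0 < rho)%R. Proof. exact: lt_trans thrho. Qed.
Let alpha : R := (theta / rho)%R.
Let al01 : (0 < alpha < 1)%R.
Proof. by rewrite /alpha divr_gt0//= ltr_pdivrMr// mul1r. Qed.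
Let s : R := Num.min kappa z.
Let s0 : (0 < s)%R. Proof. by rewrite lt_min z0 andbT; case/andP: kappa0. Qed.

Let mW a : measurable_fun setT (W a).
Proof. exact: measurable_exp_weight. Qed.

Let mC : measurable C.
Proof.
rewrite (_ : C = e @^-1` `]-oo, R1]%classic); last first.
  by apply/seteqP; split => x /=; rewrite in_itv.
by rewrite -[X in measurable X]setTI; exact: me.
Qed.

(** Apply [taboo_le_geometric] with a horizon-dependent level [M = n^(1/rho)]: both
    [kappa M^(theta - rho) n] and [z M^theta] are then multiples of [n^alpha]. *)
Lemma taboo_le_stretched n x :
  taboo P C n x <= ((2 * stretched (- s) alpha n) * W z x)%:E.
Proof.
have Wz y : (1 <= W z y)%R by apply: exp_weight_ge1; exact: ltW.
case: n => [|n].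
  have /andP[al0 _] := al01.
  rewrite lee_fin /stretched mulr0n powR0 ?gt_eqF// mulr0 expR0 mulr1.
  by apply: mulr_ege1 => //; rewrite ler1n.
have kap0 : (0 < kappa)%R by case/andP: kappa0.
have kap1 : (kappa <= 1)%R by case/andP: kappa0 => _; lra.
pose m : R := n.+1%:R.
have m1 : (1 <= m)%R by rewrite /m ler1n.
have m0 : (0 < m)%R by exact: lt_le_trans m1.
have Mth : ((m `^ rho^-1) `^ theta = m `^ alpha)%R by rewrite -powRrM mulrC.
have M1 : (1 <= m `^ rho^-1)%R.
  by rewrite -[leLHS](powRr0 m); apply: ler_powR => //; rewrite invr_ge0 ltW.
have M0 : (0 < m `^ rho^-1)%R by exact: lt_le_trans M1.
set M := (m `^ rho^-1)%R in Mth M1 M0.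
have h0 : (0 < M `^ (theta - rho))%R by exact: powR_gt0.
have h1 : (M `^ (theta - rho) <= 1)%R.
  by rewrite -[leRHS](powRr0 M); apply: ler_powR => //; rewrite subr_le0 ltW.
have k01 : (0 <= kappa * M `^ (theta - rho) <= 1)%R.
  by apply/andP; split; [apply: mulr_ge0; exact: ltW|apply: mulr_ile1 => //; exact: ltW].
have D0 : (0 <= expR (- (z * M `^ theta)))%R by exact: expR_ge0.
apply: le_trans (@taboo_le_geometric _ _ _ P C (W z) mC Wz (mW z) _ _ n.+1 x k01 D0 _) _.
  move=> y Cy; have yR : (R1 <= e y)%R by rewrite leNgt; apply/negP => /ltW.
  have [yM|My] := leP (e y) M; [left|right].
    apply: le_trans (drift_out yR) _; rewrite lee_fin ler_wpM2r ?expR_ge0//.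
    rewrite lerD2l lerN2 ler_pM2l//; apply: ler_powRn => //.
      by apply: lt_le_trans yR; apply: lt_le_trans R11.
    by rewrite subr_le0 ltW.
  rewrite -expRD -[leLHS]expR0 ler_expR addrC subr_ge0 ler_pM2l//.
  by apply: ge0_ler_powR; rewrite ?nnegrE// ltW.
rewrite lee_fin ler_wpM2r ?expR_ge0// mulr_natl mulr2n; apply: lerD.
  apply: (@le_trans _ _ (expR (- (kappa * M `^ (theta - rho))) ^+ n.+1)%R).
    rewrite lerXn2r ?nnegrE ?expR_ge0//; first by case/andP: k01; rewrite subr_ge0.
    exact: expR_ge1Dx.
  rewrite -expRM_natl ler_expR -/m mulrN mulNr lerN2 mulrCA.
  have -> : (m * M `^ (theta - rho) = m `^ alpha)%R.
    rewrite /M -powRrM (_ : rho^-1 * (theta - rho) = alpha - 1)%R.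
      by rewrite mulr_powRB1 ?(ltW m0)//; case/andP: al01.
    by rewrite /alpha; field; rewrite gt_eqF.
  by rewrite ler_wpM2r ?powR_ge0// ge_min lexx.
by rewrite Mth ler_expR mulNr lerN2 ler_wpM2r ?powR_ge0// ge_min lexx orbT.
Qed.

Variables (law : nat -> {measure set T -> \bar R}) (B : set T).
Hypothesis mB : measurable B.
Hypothesis lawS : forall k (h : T -> \bar R), (forall x, 0 <= h x) ->
  measurable_fun setT h -> \int[law k.+1]_x h x <= \int[law k]_x \int[P x]_y h y.
Hypothesis law_le1 : forall k, law k setT <= 1.
Hypothesis law_hit : forall k, law k.+1 B = 0.
Variables (N : nat) (p : R).
Hypotheses (N0 : (0 < N)%N) (p0 : (0 < p)%R).
Hypothesis reach : forall x, C x -> p%:E <= kiter P N x B.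
Hypothesis initial : \int[law 0]_x (W z x)%:E < +oo.

Let Wge0 a x : 0 <= (W a x)%:E. Proof. by rewrite lee_fin exp_weight_ge0. Qed.

Let L : R := fine (\int[law 0]_x (W z x)%:E).
Let LE : \int[law 0]_x (W z x)%:E = L%:E.
Proof. by rewrite fineK// ge0_fin_numE//; apply: integral_ge0 => x _; exact: Wge0. Qed.
Let L0 : (0 <= L)%R.
Proof. by rewrite fine_ge0//; apply: integral_ge0 => x _; exact: Wge0. Qed.

Let lawfin k A : measurable A -> law k A \is a fin_num.
Proof.
move=> mA; rewrite ge0_fin_numE//; apply: (@le_lt_trans _ _ 1); last exact: ltry.
by apply: le_trans (law_le1 k); apply: le_measure; rewrite ?inE.
Qed.

Lemma survival_sum_bounded : exists M, forall n,
  (\sum_(k < n) stretched (s / 2) alpha k * fine (law k setT) <= M)%R.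
Proof.
pose t n := (2 * stretched (- s) alpha n)%R.
have t_ge0 n : (0 <= t n)%R by rewrite mulr_ge0// expR_ge0.
have s20 : (0 < s / 2)%R by rewrite divr_gt0.
have s2s : (s / 2 < s)%R by rewrite ltr_pdivrMr// ltr_pMr// ltr1n.
have [T0 T00 hT] := stretched_product_summable s20 s2s al01.
have al : (0 <= alpha <= 1)%R by case/andP: al01 => /ltW -> /ltW.
apply: (@renewal_bounded _ (fun k => fine (law k setT)) (fun k => fine (law k C))
  (stretched (s / 2) alpha) (stretched (- s) alpha)
  p (2 * L)%R (2 * (b + 1))%R T0 N).
- move=> k; rewrite fine_ge0//= -lee_fin fineK; last exact: lawfin.
  exact: law_le1.
- by move=> k; rewrite fine_ge0.
- exact: p0.
- by rewrite mulr_ge0.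
- by rewrite mulr_gt0// ltr_wpDl.
- exact: T00.
- by move=> k; exact: stretched_gt0.
- by move=> k; exact/ltW/stretched_gt0.
- by move=> m n; apply: stretched_le; [exact: ltW|case/andP: al].
- by move=> m n; apply: stretched_submul => //; exact: ltW.
- by move=> eps eps0; exact: stretched_slow.
- exact: hT.
- move=> k; rewrite lerBrDr -lee_fin EFinD EFinM !fineK; [|exact: lawfin..].
  exact: (@killed_law_visits _ _ _ P law B mB lawS law_hit C N p k mC N0 p0 reach).
- move=> k; rewrite -lee_fin fineK; last exact: lawfin.
  have Wz y : (1 <= W z y)%R by apply: exp_weight_ge1; exact: ltW.
  have := @last_exit_decomposition _ _ _ P C (W z) mC Wz (mW z) law lawS t b t_ge0 b0
    taboo_le_stretched drift_in k 0%N.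
  rewrite addn0 integral_cst// mul1e => /le_trans; apply.
  rewrite EFinD; apply: leeD.
    apply: (@le_trans _ _ (\int[law 0]_x ((t k)%:E * (W z x)%:E))).
      apply: ge0_le_integral => //.
      - by move=> x _; exact: taboo_ge0.
      - exact: measurable_taboo.
      - by apply: measurable_funeM; exact/measurable_EFinP.
      - by move=> x _; exact: taboo_le_stretched.
    rewrite ge0_integralZl//; last 2 first.
    - exact/measurable_EFinP.
    - by rewrite lee_fin.
    by rewrite LE -EFinM lee_fin /t mulrAC.
  rewrite mulr_sumr -sumEFin; apply: lee_sum => j _.
  rewrite addn0 -[law j C]fineK; last exact: lawfin.
  rewrite -EFinM lee_fin /t; have := stretched_gt0 (- s) alpha (k - j.+1).
  have : (0 <= fine (law j C))%R by rewrite fine_ge0.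
  move: (stretched _ _ _) (fine _) => u w w0 u0.
  rewrite /= [leRHS](_ : _ = b * (2 * u) * w + 2 * (u * w))%R; last by ring.
  by rewrite lerDl !mulr_ge0// ltW.
Qed.

(** The loss [kappa e^(theta - rho) W z] of the drift inequality dominates a multiple
    of [W (z / 2)], because [e^(rho - theta)] is at most a multiple of [W (z / 2)]. *)
Lemma weighted_sum_bounded : exists M : R, forall n,
  \sum_(k < n) \int[law k]_x (W (z / 2) x)%:E <= M%:E.
Proof.
have [M hM] := survival_sum_bounded.
have z20 : (0 < z / 2)%R by rewrite divr_gt0.
have rth0 : (0 <= rho - theta)%R by rewrite subr_ge0 ltW.
have [K K0 hK] := powR_le_expR th0 z20 rth0.
have kap0 : (0 < kappa)%R by case/andP: kappa0.
pose dl := (kappa / K)%R.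
have dl0 : (0 < dl)%R by rewrite divr_gt0.
pose b' := (b + dl * expR (z * R1 `^ theta))%R.
have b'0 : (0 <= b')%R by rewrite addr_ge0// mulr_ge0 ?expR_ge0// ltW.
have drift x : \int[P x]_y (W z y)%:E + (dl * W (z / 2) x)%:E <= (W z x + b')%:E.
  have [xR|Rx] := leP (e x) R1.
    apply: (@le_trans _ _ (b%:E + (dl * expR (z * R1 `^ theta))%:E)).
      apply: leeD; first exact: drift_in.
      rewrite lee_fin ler_pM2l// ler_expR; apply: ler_pM; rewrite ?powR_ge0 ?(ltW z20)//.
        by lra.
      by apply: ge0_ler_powR; rewrite ?nnegrE ?(ltW th0)// (le_trans _ xR).
    by rewrite -EFinD lee_fin -/b' lerDr expR_ge0.
  apply: (@le_trans _ _ (((1 - kappa * e x `^ (theta - rho)) * W z x)%:E +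
      (kappa * e x `^ (theta - rho) * W z x)%:E)); last first.
    by rewrite -EFinD lee_fin -mulrDl subrK mul1r lerDl.
  apply: leeD; first exact/drift_out/ltW.
  have ex0 : (0 < e x)%R by apply: lt_trans Rx; apply: lt_le_trans R11.
  rewrite lee_fin /dl -!mulrA ler_pM2l// mulrC ler_pdivrMr//.
  have -> : W z x = (W (z / 2) x * W (z / 2) x)%R by rewrite -exp_weightD -splitr.
  have hinv : (1 <= e x `^ (theta - rho) * (K * W (z / 2) x))%R.
    rewrite [leLHS](_ : _ = e x `^ (theta - rho) * e x `^ (rho - theta))%R; last first.
      by rewrite -gt0_powRD// [X in powR _ X](_ : _ = 0)%R ?powRr0//; ring.
    by apply: ler_wpM2l; [exact: powR_ge0|exact: (hK _ (e0 x))].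
  rewrite [leRHS](_ : _ =
    (e x `^ (theta - rho) * (K * W (z / 2) x) * W (z / 2) x)%R); last by ring.
  by rewrite -[leLHS]mul1r ler_wpM2r// expR_ge0.
exists ((L + b' * M) / dl)%R => n.
have F0 x : (0 <= dl * W (z / 2) x)%R by rewrite mulr_ge0 ?expR_ge0// ltW.
have W0 x : (0 <= W z x)%R by exact: expR_ge0.
have mF : measurable_fun setT (fun x => dl * W (z / 2) x)%R by exact: measurable_funM.
have h := killed_law_drift lawS n b'0 W0 F0 (mW z) mF drift.
have {h} : \sum_(k < n) \int[law k]_x (dl * W (z / 2) x)%:E <= (L + b' * M)%:E.
  apply: (@le_trans _ _ (\int[law n]_x (W z x)%:E +
      \sum_(k < n) \int[law k]_x (dl * W (z / 2) x)%:E)).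
    by rewrite leeDr// integral_ge0.
  apply: le_trans h _; rewrite LE [leRHS]EFinD; apply: leeD => //.
  rewrite -ge0_sume_distrr// EFinM; apply: lee_wpmul2l; first by rewrite lee_fin.
  apply: (@le_trans _ _ (\sum_(k < n) fine (law k setT))%R%:E).
    rewrite -sumEFin; apply: lee_sum => k _; rewrite fineK//; exact: lawfin.
  rewrite lee_fin; apply: le_trans (hM n); apply: ler_sum => k _.
  rewrite ler_peMl ?fine_ge0// -[leLHS]expR0 ler_expR mulr_ge0 ?powR_ge0//.
  by rewrite divr_ge0// ltW.
have -> : \sum_(k < n) \int[law k]_x (dl * W (z / 2) x)%:E =
    dl%:E * \sum_(k < n) \int[law k]_x (W (z / 2) x)%:E.
  rewrite ge0_sume_distrr; last by move=> k _; exact: integral_ge0.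
  apply: eq_bigr => k _; under eq_integral do rewrite EFinM.
  by rewrite ge0_integralZl ?lee_fin ?(ltW dl0)//; exact/measurable_EFinP.
by move=> h; rewrite [leRHS]EFinM lee_pdivlMr// muleC.
Qed.

(** [u v <= u^2 + v^2] separates time from space; squaring doubles the exponents,
    which is why they start from a quarter. *)
Lemma subgeometric_moment_bounded : exists M : R, forall n,
  \sum_(k < n) \int[law k]_x (stretched (s / 4) alpha k * W (z / 4) x)%:E <= M%:E.
Proof.
have [M1 hM1] := survival_sum_bounded.
have [M2 hM2] := weighted_sum_bounded.
exists (M1 + M2)%R => n.
apply: (@le_trans _ _ (\sum_(k < n) ((stretched (s / 2) alpha k * fine (law k setT))%:E +
   \int[law k]_x (W (z / 2) x)%:E))); last first.
  rewrite big_split/= EFinD; apply: leeD; last exact: hM2.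
  by rewrite sumEFin lee_fin; exact: hM1.
apply: lee_sum => k _.
have r20 : (0 <= stretched (s / 2) alpha k)%R by exact: expR_ge0.
apply: (@le_trans _ _ (\int[law k]_x ((stretched (s / 2) alpha k)%:E + (W (z / 2) x)%:E))).
  apply: ge0_le_integral => //.
  - by move=> x _; rewrite lee_fin; apply: mulr_ge0; exact: expR_ge0.
  - by apply/measurable_EFinP; exact: measurable_funM.
  - by apply: emeasurable_funD => //; exact/measurable_EFinP.
  move=> x _; rewrite -EFinD lee_fin.
  have -> : stretched (s / 2) alpha k = (stretched (s / 4) alpha k ^+ 2)%R.
    by rewrite expr2 -expRD; congr expR; field.
  have -> : W (z / 2) x = (W (z / 4) x ^+ 2)%R.
    by rewrite expr2 -exp_weightD; congr (exp_weight _ _ _ _); field.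
  have := expR_gt0 (s / 4 * k%:R `^ alpha); have := expR_gt0 (z / 4 * e x `^ theta).
  rewrite /stretched /exp_weight; move: (expR _) (expR _) => u v; nra.
rewrite ge0_integralD//; last by exact/measurable_EFinP.
rewrite leeD2r// integral_cst// EFinM fineK//; exact: lawfin.
Qed.

End subgeometric_regularity.

(** * The autoregressive chain *)

Theorem corollary3p4 (R : realType) (d : nat) (hd : (0 < d)%N)
    (dO : measure_display) (Omega : measurableType dO) (Pr : probability Omega R)
    (Phi0 : {RV Pr >-> 'rV[R]_d}) (eps : nat -> {RV Pr >-> 'rV[R]_d})
    (g : 'rV[R]_d -> 'rV[R]_d) (P : R.-pker 'rV[R]_d ~> 'rV[R]_d)
    (z0 gamma0 rho : R)
    (hz0 : 0 < z0) (hgamma0 : 0 < gamma0 <= 1) (hrho : 0 <= rho < 2)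
    (hnoise : noise_assumption Phi0 eps z0 gamma0)
    (hg : drift_assumption g rho)
    (hP : forall (x : 'rV[R]_d) (A : set 'rV[R]_d), measurable A ->
       P x A = Pr [set w | A (g x + eps 0%N w)])
    (hg_le : forall x : 'rV[R]_d, enorm (g x) <= enorm x) :
  psi_irreducible P /\
  forall psi : {sigma_finite_measure set 'rV[R]_d -> \bar R},
    maximal_irreducibility_measure P psi ->
    [/\ aperiodic P psi,
        forall C : set 'rV[R]_d, compact C -> Bplus psi C -> petite P C &
        gamma0 < rho ->
        let theta := Num.min gamma0 (2 - rho) in
        exists zstar c z : R,
          [/\ 0 < zstar < z0, 0 < c, 0 < z < z0 &
              let V := fun x : 'rV[R]_d => expR (zstar * enorm x `^ theta) in
              let f := fun x : 'rV[R]_d => expR (z * enorm x `^ theta) in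
              let r := fun n : nat => expR (c * n%:R `^ (theta / rho)) in
              forall lam : probability 'rV[R]_d R,
                (\int[lam]_x (V x)%:E < +oo)%E -> regular P psi f r lam]].
Proof.
have [_ _ mean0 moment ac] := hnoise.
have [g0 g1] := andP hgamma0.
have [rho_ge0 rho_lt2] := andP hrho.
pose mu : {measure set 'rV[R]_d -> \bar R} := distribution Pr (eps 0%N).
have PE x A : measurable A -> P x A = mu ((fun u => g x + u) @^-1` A).
  by move=> mA; rewrite hP.
have [c [delta [c0 delta0 mu_ge]]] := ac_component_lower_bound ac.
have minor := uniform_minorization PE hg_le c0 delta0 mu_ge.
have nu0 := minorizing_measure_gt0 (d := d) c0 delta0.
have nuoo := minorizing_measure_fin (d := d) c0 delta0.
split.
  apply: (minorized_psi_irreducible nu0 nuoo) => x.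
  have [n [k [k0 hk]]] := minor (enorm x).
  by exists n, k; split => // A j mA; exact: hk.
move=> psi psi_max; have psi_irr := psi_max.1; split.
- apply: (minorized_aperiodic nu0 nuoo _ (measurable_enorm_le (delta / 3))
    (minorizing_measure_outside delta c0)) psi_max.
    move=> x; have [n [k [k0 hk]]] := minor (enorm x).
    by exists n, k; split => // A j mA; exact: hk.
  by move=> x A Ux mA; exact: (kernel_minorization PE hg_le delta0 mu_ge).
- move=> C Ccompact [mC _].
  have [M CM] : exists M, forall x, C x -> enorm x <= M.
    have [M [_ CM]] := compact_bounded Ccompact.
    exists (d%:R * (`|M| + 2)) => x Cx; apply: enorm_le_coord; first by rewrite addr_ge0.
    move=> i; have : `|x| < `|M| + 2.
      apply: (@le_lt_trans _ _ (`|M| + 1)); last by rewrite ltrD2l ltr1n.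
      by apply: CM => //; rewrite ltr_pwDr// ler_norm.
    move=> xM; have : ball (0 : 'rV[R]_d) (`|M| + 2) x.
      by rewrite -ball_normE/= sub0r normrN.
    move=> [_ /(_ ord0 i)]; rewrite mxE /ball/= sub0r normrN; exact: ltW.
  have [n [k [k0 hk]]] := minor M.
  by apply: (minorized_petite nu0 mC k0) => x Cx; exact: hk (CM x Cx).
move=> g_rho theta.
have th0 : 0 < theta by rewrite lt_min g0 subr_gt0.
have thg : theta <= gamma0 by rewrite ge_min lexx.
have th2 : theta <= 2 - rho by rewrite ge_min lexx orbT.
have thrho : theta < rho by exact: le_lt_trans g_rho.
have hP0 (x : 'rV[R]_d) (A : set 'rV[R]_d) : measurable A ->
  P x A = Pr [set w | A (g x + eps 0%N w)] by exact: hP.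
have [z [kappa [R1 [b [zz0 kappa0 [R11 b0] out in_]]]]] :=
  autoregressive_drift hP0 hz0 hgamma0 (mean0 0%N) moment hg hg_le th0 thg th2 thrho rho_lt2.
have [z0' zlt] := andP zz0.
have s0 : 0 < Num.min kappa z by rewrite lt_min z0' andbT; case/andP: kappa0.
exists z, (Num.min kappa z / 4), (z / 4); split => //.
- by rewrite divr_gt0.
- by rewrite divr_gt0//= (lt_trans _ zlt)// ltr_pdivrMr// ltr_pMr// ltr1n.
move=> V f r lam lamV B [mB psiB] dQ OmQ Q Phi chain.
have [n [k [k0 hk]]] := minor R1.
have [N [p [N0 p0 reach]]] : exists N (p : R), [/\ (0 < N)%N, 0 < p &
    forall x, enorm x <= R1 -> (p%:E <= kiter P N x B)%E].
  apply: (minorized_reaches nu0 nuoo k0 _ mB) => //.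
    by move=> x xR1 A j mA; exact: hk.
  by move=> x; have [m _ hm] := psi_irr.2 B mB psiB x; exists m.
have mV : measurable_fun setT (fun x => (V x)%:E).
  by apply/measurable_EFinP; exact: measurable_exp_weight measurable_enorm.
have init : (\int[killed_law Phi mB 0]_x (V x)%:E < +oo)%E.
  rewrite (eq_measure_integral lam)// => A mA _.
  exact: (killed_law0 chain mB).
have [M hM] := subgeometric_moment_bounded (@enorm_ge0 R d) measurable_enorm z0' kappa0
  R11 b0 th0 thrho out in_ mB (killed_lawS chain mB) (killed_law_le1 Phi mB)
  (killed_law_hit Phi mB) N0 p0 reach init.
rewrite (integral_until_hitting Phi mB (u := fun k x => (r k * f x)%:E)); last 2 first.
- by move=> i x; rewrite lee_fin mulr_ge0 ?expR_ge0.
- move=> i; apply/measurable_EFinP; apply: measurable_funM => //.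
  exact: measurable_exp_weight measurable_enorm.
apply: (@le_lt_trans _ _ M%:E); last exact: ltry.
apply: lime_le.
  apply: is_cvg_nneseries => i _ _; apply: integral_ge0 => x _.
  by rewrite lee_fin mulr_ge0 ?expR_ge0.
by apply: nearW => i; rewrite big_mkord; exact: hM.
Qed.
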